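(* Let $n>1$, let $W$ be an admissible interaction potential with convexity matrix $\kappa$, and assume that the interaction system is irreducible. For $i\in\{1,\ldots,n\}$ put $\eta_i:=\min_{j\neq i}\kappa_{ij}m_j\in\mathbb{R}$, and define $$\lambda_0:=\min_{i\in\{1,\ldots,n\}}\left[p_i\min(0,m_i\kappa_{ii}-\eta_i)+\frac12\sum_{j=1}^n p_j\left(\eta_j+\eta_i\frac{m_i}{m_j}\right)\right].$$ Then, for every $\lambda\le\lambda_0$, the interaction energy $\mathcal{W}$ is $\lambda$-convex along generalized geodesics on $(\mathscr{P},\mathbf{W}_{\mathscr{P}})$.
   Context: Let $d,n\in\mathbb{N}$, $m_1,\ldots,m_n>0$, $p_1,\ldots,p_n>0$, $E\in\mathbb{R}^d$ be fixed. Admissible interaction potential: a map $W:\mathbb{R}^d\to\mathbb{R}^{n\times n}$ such that $W(z)$ is a symmetric matrix for each $z$; $W_{ij}\in C^1(\mathbb{R}^d;\mathbb{R})$ for all $i,j$; $W(z)=W(-z)$ for all $z$; there is a matrix $\overline W\in\mathbb{R}^{n\times n}$ with $|W_{ij}(z)|\le\overline W_{ij}(1+|z|^2)$ for all $z,i,j$; and there is a symmetric matrix $\kappa\in\mathbb{R}^{n\times n}$ (the convexity matrix, fixed) such that $z\mapsto W_{ij}(z)-\frac12\kappa_{ij}|z|^2$ is convex for all $i,j$. Interaction system: $\partial_t\mu_i=\mathrm{div}\big[m_i\mu_i\nabla\big(\sum_{j=1}^nW_{ij}*\mu_j\big)\big]$, $i=1,\ldots,n$. It is called irreducible if the graph with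 nodes $\{1,\ldots,n\}$ and edges $\{(i,j):\nabla W_{ij}\not\equiv0\text{ on }\mathbb{R}^d\}$ is connected. $\mathscr{P}$ is the set of $n$-tuples $\mu=(\mu_1,\ldots,\mu_n)$ of nonnegative Borel measures on $\mathbb{R}^d$ with $\mu_j(\mathbb{R}^d)=p_j$, finite second moments, and $\sum_{j=1}^n\frac1{m_j}\int_{\mathbb{R}^d}x\,\mathrm{d}\mu_j(x)=E$. For finite measures $\alpha,\beta$ of equal mass, $\Gamma(\alpha,\beta)$ denotes the set of finite Borel measures on $\mathbb{R}^d\times\mathbb{R}^d$ with marginals $\alpha$ and $\beta$. The distance on $\mathscr{P}$ is $$\mathbf{W}_{\mathscr{P}}(\mu^0,\mu^1)=\Big[\sum_{j=1}^n\frac1{m_j}\inf\Big\{\int|x-y|^2\,\mathrm{d}\gamma_j(x,y):\gamma_j\in\Gamma(\mu^0_j,\mu^1_j)\Big\}\Big]^{1/2}.$$ The interaction energy is $\mathcal{W}(\mu)=\frac12\sum_{i,j=1}^n\int\int W_{ij}(x-y)\,\mathrm{d}\mu_i(x)\,\mathrm{d}\mu_j(y)$. $\lambda$-convexity along generalized geodesics: a functional $\mathfrak{A}:\mathscr{P}\to\mathbb{R}\cup\{+\infty\}$ is $\lambda$-convex along generalized geodesics on $(\mathscr{P},\mathbf{W}_{\mathscr{P}})$ if for any $\mu^1,\mu^2,\mu^3\in\mathscr{P}$ there exists an $n$-tuple $\boldsymbol{\mu}=(\boldsymbol\mu_1,\ldots,\boldsymbol\mu_n)$ of Borel measures on $\mathbb{R}^d\times\mathbb{R}^d\times\mathbb{R}^d$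 such that, with $\pi^k$ the projection to the $k$-th factor and $\pi^{(1,k)}$ the projection to the first and $k$-th factors: (1) $\pi^k{}_\#\boldsymbol\mu_j=\mu^k_j$ for all $j$ and $k\in\{1,2,3\}$; (2) for $k\in\{2,3\}$ and all $j$, $\pi^{(1,k)}{}_\#\boldsymbol\mu_j$ minimizes $\int|x^1-x^k|^2\,\mathrm{d}\gamma_j(x^1,x^k)$ over $\gamma_j\in\Gamma(\mu^1_j,\mu^k_j)$; (3) with $\mu_{s,j}:=[(1-s)\pi^2+s\pi^3]_\#\boldsymbol\mu_j$ and $\mu_s=(\mu_{s,1},\ldots,\mu_{s,n})$, for all $s\in[0,1]$, $$\mathfrak{A}(\mu_s)\le(1-s)\mathfrak{A}(\mu^2)+s\mathfrak{A}(\mu^3)-\frac\lambda2s(1-s)\sum_{j=1}^n\frac1{m_j}\int|x^3-x^2|^2\,\mathrm{d}\boldsymbol\mu_j(x^1,x^2,x^3).$$ *)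

(* Defs.v *)
From HB Require Import structures.
From mathcomp Require Import all_boot all_order all_algebra.
From mathcomp Require Import all_classical all_reals all_analysis.
From mathcomp Require Import measurable_realfun.

Set Implicit Arguments.
Unset Strict Implicit.
Unset Printing Implicit Defensive.

Import Order.TTheory GRing.Theory Num.Theory.
Import numFieldNormedType.Exports.

Local Open Scope classical_set_scope.
Local Open Scope ring_scope.

(* R^d is 'rV[R]_d with its Borel sigma-algebra. Since R^d is second countable,
   the product sigma-algebras that MathComp-Analysis puts on R^d * R^d and
   R^d * R^d * R^d are again the Borel ones. *)
Definition borel_display : measure_display.
Proof. exact: default_measure_display. Qed.

Section borel_rV.
Context (R : realType) (d : nat).

Definition borel_rV : set (set 'rV[R]_d) := <<s open >>.

Let borel_rV0 : borel_rV set0. Proof. exact: sigma_algebra0. Qed.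

Let borel_rVC A : borel_rV A -> borel_rV (~` A).
Proof. by move=> ?; rewrite -setTD; exact: sigma_algebraCD. Qed.

Let borel_rV_bigcup (F : (set 'rV[R]_d)^nat) :
  (forall i, borel_rV (F i)) -> borel_rV (\bigcup_i F i).
Proof. exact: sigma_algebra_bigcup. Qed.

HB.instance Definition _ := @isMeasurable.Build borel_display 'rV[R]_d
  borel_rV borel_rV0 borel_rVC borel_rV_bigcup.

Lemma open_measurable_rV (A : set 'rV[R]_d) : open A -> measurable A.
Proof. exact: sub_sigma_algebra. Qed.

Lemma measurable_coord (k : 'I_d) :
  measurable_fun [set: 'rV[R]_d] (fun x : 'rV[R]_d => x 0 k : R).
Proof.
apply: (measurability _ (RGenOpens.measurableE R)).
move=> _ [_ [a [b ->]] <-]; rewrite setTI; apply: open_measurable_rV.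
by apply: open_comp => [x _|]; [exact: coord_continuous|exact: interval_open].
Qed.

Lemma open_rV_bigcup (U : set 'rV[R]_d) : open U ->
  U = \bigcup_(q : 'rV[rat]_d * nat)
    [set x | ball (map_mx ratr q.1 : 'rV[R]_d) q.2.+1%:R^-1 x /\
       ball (map_mx ratr q.1 : 'rV[R]_d) q.2.+1%:R^-1 `<=` U].
Proof.
move=> oU; apply/seteqP; split => [x Ux|x [q _ [/[swap]]]]; last exact.
have /nbhs_ballP[e /= e0 xeU] : nbhs x U by exact: open_nbhs_nbhs.
have [n ne] : exists n, n.+1%:R^-1 < e / 2.
  have e20 : 0 < e / 2 by rewrite divr_gt0.
  have [n _ /(_ n (leqnn n)) ne] := near_infty_natSinv_lt (PosNum e20).
  by exists n.
have n0 : 0 < n.+1%:R^-1 :> R by rewrite invr_gt0.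
have /choice[q xq] (k : 'I_d) :
    exists q : rat, ball (x 0 k : R) n.+1%:R^-1 (ratr q).
  have [] := @dense_rat R (ball (x 0 k) n.+1%:R^-1).
  - by exists (x 0 k); exact: ballxx.
  - exact: ball_open.
  - by move=> z [bx [q _ qz]]; exists q; rewrite qz.
exists (\row_k q k, n) => //=; split=> [|y].
  by split=> // i j; rewrite !mxE ord1; apply: ball_sym; exact: xq.
move=> [_ yq]; apply: xeU; split=> // i j.
have := yq i j; rewrite !mxE (ord1 i) => qy; rewrite (splitr e).
apply: (le_ball (ltW (ltrD ne ne))).
exact: ball_triangle (xq j) qy.
Qed.

Lemma measurable_fun_rVP d' (T : measurableType d') (f : T -> 'rV[R]_d) :
  measurable_fun [set: T] f <->
  forall k, measurable_fun [set: T] (fun t => f t 0 k : R).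
Proof.
split=> [mf k|mf].
  exact: (measurableT_comp (measurable_coord k) mf).
apply: (measurability (@open 'rV[R]_d)) => // _ [U oU <-].
rewrite setTI (open_rV_bigcup oU) preimage_bigcup.
apply: countable_bigcupT_measurable => // -[q n] /=.
have [qU|qU] := pselect (ball (map_mx ratr q : 'rV[R]_d) n.+1%:R^-1 `<=` U).
  rewrite [X in measurable X](_ : _ = \bigcap_(k in [set: 'I_d])
      ((fun t => f t 0 k : R) @^-1` ball (ratr (q 0 k) : R) n.+1%:R^-1)).
    apply: fin_bigcap_measurable => // k _; rewrite -[X in measurable X]setTI.
    by apply: mf => //; exact: measurable_ball.
  apply/seteqP; split=> t /=.
    by move=> [[_ bt] _] k _; have := bt 0 k; rewrite mxE.
  move=> bt; split=> //; split=> [|i k]; first by rewrite invr_gt0.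
  by rewrite !mxE ord1; exact: bt.
rewrite [X in measurable X](_ : _ = set0) //.
by rewrite -subset0 => t /= [_ /qU].
Qed.

End borel_rV.

Section image_measure.
Context d1 d2 (T1 : measurableType d1) (T2 : measurableType d2) (R : realType).

Definition image_measure (mu : {measure set T1 -> \bar R})
  (f : {mfun T1 >-> T2}) : set T2 -> \bar R := pushforward mu f.

Variables (mu : {measure set T1 -> \bar R}) (f : {mfun T1 >-> T2}).

Let image_measure0 : image_measure mu f set0 = 0%E.
Proof. exact: measure0. Qed.

Let image_measure_ge0 A : (0 <= image_measure mu f A)%E.
Proof. exact: measure_ge0. Qed.

Let image_measure_sigma_additive : semi_sigma_additive (image_measure mu f).
Proof. exact: measure_semi_sigma_additive. Qed.

HB.instance Definition _ := isMeasure.Build _ _ _ (image_measure mu f)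
  image_measure0 image_measure_ge0 image_measure_sigma_additive.

(* Measures are total functions on [set T1], with arbitrary values on
   non-measurable sets, so they are only compared on measurable sets. *)
Definition same_measure (nu1 nu2 : set T1 -> \bar R) : Prop :=
  forall A, measurable A -> nu1 A = nu2 A.

End image_measure.

Section triple_maps.
Context (R : realType) (d : nat).
Local Notation V := 'rV[R]_d.

(* A point (x1, x2, x3) is the nested pair ((x1, x2), x3). *)
Definition pi1 (x : V * V * V) : V := x.1.1.
Definition pi2 (x : V * V * V) : V := x.1.2.
Definition pi3 (x : V * V * V) : V := x.2.
Definition pi12 (x : V * V * V) : V * V := (pi1 x, pi2 x).
Definition pi13 (x : V * V * V) : V * V := (pi1 x, pi3 x).
Definition interp (s : R) (x : V * V * V) : V :=
  (1 - s) *: pi2 x + s *: pi3 x.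

Let measurable_pi1 : measurable_fun setT pi1.
Proof. exact: (measurableT_comp measurable_fst measurable_fst). Qed.

Let measurable_pi2 : measurable_fun setT pi2.
Proof. exact: (measurableT_comp measurable_snd measurable_fst). Qed.

Let measurable_pi3 : measurable_fun setT pi3.
Proof. exact: measurable_snd. Qed.

HB.instance Definition _ := isMeasurableFun.Build _ _ _ _ pi1 measurable_pi1.
HB.instance Definition _ := isMeasurableFun.Build _ _ _ _ pi2 measurable_pi2.
HB.instance Definition _ := isMeasurableFun.Build _ _ _ _ pi3 measurable_pi3.

Let measurable_pi12 : measurable_fun setT pi12.
Proof. exact: measurable_fun_pair. Qed.

Let measurable_pi13 : measurable_fun setT pi13.
Proof. exact: measurable_fun_pair. Qed.

HB.instance Definition _ := isMeasurableFun.Build _ _ _ _ pi12 measurable_pi12.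
HB.instance Definition _ := isMeasurableFun.Build _ _ _ _ pi13 measurable_pi13.

Let measurable_interp s : measurable_fun setT (interp s).
Proof.
apply/measurable_fun_rVP => k.
under eq_fun do rewrite !mxE.
by apply: measurable_funD; apply: measurable_funM => //;
  apply: (measurableT_comp (measurable_coord k)).
Qed.

HB.instance Definition _ s :=
  isMeasurableFun.Build _ _ _ _ (interp s) (measurable_interp s).

End triple_maps.

Section potentials.
Context (R : realType) (d n : nat).
Local Notation V := 'rV[R]_d.

(* The library norm `|x| on 'rV[R]_d is the sup norm; this is the square of the
   Euclidean one. *)
Definition sqnorm (x : V) : R := \sum_(k < d) x 0 k ^+ 2.

Definition grad (f : V -> R) (z : V) : V := \row_k 'D_(delta_mx 0 k) f z.

Definition C1 (f : V -> R) : Prop :=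
  (forall z, differentiable f z) /\ continuous (grad f).

Record admissible (W : V -> 'M[R]_n) (kappa : 'M[R]_n) : Prop := Admissible {
  admissible_sym : forall z, (W z)^T = W z;
  admissible_C1 : forall i j, C1 (fun z => W z i j);
  admissible_even : forall z, W z = W (- z);
  admissible_growth : exists Wbar : 'M[R]_n, forall z i j,
    `|W z i j| <= Wbar i j * (1 + sqnorm z);
  admissible_kappa_sym : kappa^T = kappa;
  admissible_convex : forall i j, convex_function setT
    (fun z : convex_lmodType V => W z i j - 2^-1 * kappa i j * sqnorm z)
}.

Definition interaction_edge (W : V -> 'M[R]_n) : rel 'I_n :=
  fun i j => `[< exists z, grad (fun x => W x i j) z != 0 >].

(* For symmetric W the edge relation is symmetric, so [connect] is
   connectedness in the undirected graph. *)
Definition irreducible_system (W : V -> 'M[R]_n) : Prop :=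
  forall i j, connect (interaction_edge W) i j.

End potentials.

Section transport.
Context (R : realType) (d : nat).
Local Notation V := 'rV[R]_d.
Local Open Scope ereal_scope.

(* Couplings of finite measures are automatically finite. *)
Definition couplings (alpha beta : {measure set V -> \bar R}) :
    set {measure set (V * V) -> \bar R} :=
  [set gamma | same_measure (pushforward gamma fst) alpha /\
               same_measure (pushforward gamma snd) beta].

Definition transport_cost (gamma : {measure set (V * V) -> \bar R}) : \bar R :=
  \int[gamma]_z (sqnorm (z.1 - z.2))%:E.

Definition optimal_coupling (alpha beta : {measure set V -> \bar R})
    (gamma : {measure set (V * V) -> \bar R}) : Prop :=
  couplings alpha beta gamma /\
  forall gamma', couplings alpha beta gamma' ->
    transport_cost gamma <= transport_cost gamma'.

End transport.

Section gradient_flow_space.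
Context (R : realType) (d n : nat).
Variables (m p : 'I_n -> R) (E : 'rV[R]_d).
Local Notation V := 'rV[R]_d.
Local Notation measures := ('I_n -> {measure set V -> \bar R}).

Definition first_moment (mu : {measure set V -> \bar R}) : V :=
  \row_k \int[mu]_x x 0 k.

Definition state_space : set measures := [set mu : measures |
  [/\ forall j, mu j setT = (p j)%:E,
      forall j, (\int[mu j]_x (sqnorm x)%:E < +oo)%E &
      \sum_j (m j)^-1 *: first_moment (mu j) = E]].

(* Functionals are given on all n-tuples of measures; only their values on
   [state_space] matter, since mu_s stays in it. *)
Definition convex_along_generalized_geodesics (lambda : R)
    (A : measures -> \bar R) : Prop :=
  forall mu1 mu2 mu3, state_space mu1 -> state_space mu2 -> state_space mu3 ->
  exists bmu : 'I_n -> {measure set (V * V * V) -> \bar R},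
  [/\ forall j, [/\ same_measure (image_measure (bmu j) (@pi1 R d)) (mu1 j),
                    same_measure (image_measure (bmu j) (@pi2 R d)) (mu2 j) &
                    same_measure (image_measure (bmu j) (@pi3 R d)) (mu3 j)],
      forall j,
        optimal_coupling (mu1 j) (mu2 j) (image_measure (bmu j) (@pi12 R d)) /\
        optimal_coupling (mu1 j) (mu3 j) (image_measure (bmu j) (@pi13 R d)) &
      forall s : R, 0 <= s <= 1 ->
        (A (fun j => image_measure (bmu j) (interp s)) <=
         (1 - s)%:E * A mu2 + s%:E * A mu3 -
         (lambda / 2 * s * (1 - s))%:E *
         \sum_j (m j)^-1%:E *
           \int[bmu j]_x (sqnorm (pi3 x - pi2 x))%:E)%E].

End gradient_flow_space.

Section energy.
Context (R : realType) (d n : nat).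
Local Notation V := 'rV[R]_d.

Definition interaction_energy (W : V -> 'M[R]_n)
    (mu : 'I_n -> {measure set V -> \bar R}) : \bar R :=
  ((2^-1)%:E * \sum_(i < n) \sum_(j < n)
     \int[mu j]_y \int[mu i]_x (W (x - y) i j)%:E)%E.

End energy.

Section modulus.
Context (R : realType) (n : nat).

(* Minimum of F over the indices satisfying P; 0 if there are none. *)
Definition fmin (P : pred 'I_n) (F : 'I_n -> R) : R :=
  if [pick j | P j] is Some j0 then \big[Num.min/F j0]_(j | P j) F j else 0.

Lemma fmin_le (P : pred 'I_n) F j : P j -> fmin P F <= F j.
Proof.
move=> Pj; rewrite /fmin; case: pickP => [j0 _|/(_ j)]; last by rewrite Pj.
exact: bigmin_le_cond.
Qed.

Lemma fmin_attained (P : pred 'I_n) F j0 :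
  P j0 -> exists2 j, P j & fmin P F = F j.
Proof.
move=> Pj0; rewrite /fmin; case: pickP => [j1 Pj1|/(_ j0)]; last by rewrite Pj0.
elim/big_rec: _ => [|i x Pi [j Pj ->]]; first by exists j1.
by have [_|_] := leP (F i) (F j); [exists i|exists j].
Qed.

Variables (m p : 'I_n -> R) (kappa : 'M[R]_n).

Definition eta (i : 'I_n) : R :=
  fmin (fun j => j != i) (fun j => kappa i j * m j).

Definition lambda0 : R := fmin xpredT (fun i =>
  p i * Num.min 0 (m i * kappa i i - eta i) +
  2^-1 * \sum_(j < n) p j * (eta j + eta i * (m i / m j))).

End modulus.

(* Main.v *)
(* Convexity of [W_ij - kappa_ij / 2 |.|^2] along the segments joining [pi2] to
   [pi3] bounds the energy of the interpolated measures by the chord minus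
   [s (1 - s) / 4] times [sum_ij kappa_ij D_ij], where [D_ij] is the double
   integral of [|xi(X) - xi(Y)|^2] and [xi = pi3 - pi2]. Replacing [kappa_ij]
   by [(eta_i / m_j + eta_j / m_i) / 2] for [i <> j] leaves a quadratic form
   whose cross terms cancel because the weighted barycenters of [mu2] and [mu3]
   agree, and half of what remains is at least [lambda0] times the weighted sum
   of the integrals of [|xi|^2].

   The plans come from a compactness argument: the limit along an ultrafilter
   of a tight sequence of measures is a finitely additive set function, and its
   regularization on open sets is a measure. For a minimizing sequence of
   couplings this gives an optimal coupling. Two couplings with a common
   marginal are glued by taking, in each cell of a partition into cells of
   diameter less than [1 / (k + 1)], the product of their restrictions
   divided by the mass of the cell, and letting [k] tend to infinity. *)

From HB Require Import structures.
From mathcomp Require Import all_boot all_order all_algebra.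
From mathcomp Require Import all_classical all_reals all_analysis.
From mathcomp Require Import measurable_realfun lra ring.
Require Import Defs.

Set Implicit Arguments.
Unset Strict Implicit.
Unset Printing Implicit Defensive.

Import Order.TTheory GRing.Theory Num.Theory.
Import numFieldNormedType.Exports.

Local Open Scope classical_set_scope.
Local Open Scope ring_scope.

(** * Regularization of a tight finitely additive set function *)

Section erosion.
Context (R : realType) (X : pseudoMetricType R).
Implicit Types (O P : set X) (e : R).

(** For row vectors these sets are closed, and if [O] is open they exhaust [O] as [e] tends to 0
    from above; they are the inner approximations used in the regularization. *)
Definition erosion O e : set X := [set x | ball x e `<=` O].

Lemma erosion_sub O e : 0 < e -> erosion O e `<=` O.
Proof. by move=> e0 x; apply; exact: ballxx. Qed.

Lemma erosionS O P e : O `<=` P -> erosion O e `<=` erosion P e.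
Proof. by move=> OP x /= /subset_trans; apply. Qed.

Lemma erosion_anti O e e' : e <= e' -> erosion O e' `<=` erosion O e.
Proof. by move=> ee' x /=; apply: subset_trans; exact: le_ball. Qed.

End erosion.

Lemma closed_erosion (R : realType) N (O : set 'rV[R]_N) e :
  closed (erosion O e).
Proof.
rewrite (_ : erosion O e = ~` \bigcup_(y in ~` O) ball y e).
  by apply: open_closedC; apply: bigcup_open => y _; exact: ball_open.
apply/seteqP; split=> x /=.
  by move=> xO [y Oy /ball_sym /xO].
move=> xO y xy; apply: contrapT => Oy; apply: xO; exists y => //.
exact: ball_sym.
Qed.

Lemma closed_measurable_rV (R : realType) N (A : set 'rV[R]_N) :
  closed A -> measurable A.
Proof.
move=> cA; rewrite -(setCK A); apply: measurableC.
by apply: open_measurable_rV; exact: closed_openC.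
Qed.

(* The inner values [sup_e nu (erosion O e)] of open sets induce an outer
   measure. Tightness makes it countably subadditive, and since an erosion of
   [O] and the complement of [O] are separated, open sets are measurable for it
   in the sense of Caratheodory. *)
Section regularization.
Context (R : realType) (N : nat).
Local Notation V := 'rV[R]_N.
Context (nu : set V -> R)
  (nu_additive : forall A B, measurable A -> measurable B ->
    A `&` B = set0 -> nu (A `|` B) = nu A + nu B)
  (nu_ge0 : forall A, measurable A -> 0 <= nu A)
  (nu_tight : forall e, 0 < e ->
    exists K, [/\ compact K, closed K & nu (~` K) <= e]).

Local Open Scope ereal_scope.

Let nu0 : nu set0 = 0%R.
Proof.
have := @nu_additive set0 set0 measurable0 measurable0 (setI0 _).
rewrite setU0 => /eqP.
by rewrite -subr_eq0 opprD addNKr oppr_eq0 => /eqP.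
Qed.

Let le_nu A B : measurable A -> measurable B -> A `<=` B -> (nu A <= nu B)%R.
Proof.
move=> mA mB AB; have mBA : measurable (B `\` A) by exact: measurableD.
rewrite -(setDUK AB) nu_additive ?lerDl ?nu_ge0//.
by rewrite setDE setICA setICr setI0.
Qed.

Let nuU A B : measurable A -> measurable B -> (nu (A `|` B) <= nu A + nu B)%R.
Proof.
move=> mA mB; rewrite -(setDUK (@subsetUl _ A B)) nu_additive//.
- by rewrite lerD2l le_nu//; [apply: measurableD => //; exact: measurableU|
    by move=> x [[//|]]].
- by apply: measurableD => //; exact: measurableU.
- by rewrite setDE setICA setICr setI0.
Qed.

Let nu_bigsetU n (A : nat -> set V) : (forall i, measurable (A i)) ->
  (nu (\big[setU/set0]_(i < n) A i) <= \sum_(i < n) nu (A i))%R.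
Proof.
move=> mA; elim: n => [|n ih]; first by rewrite !big_ord0 nu0.
rewrite !big_ord_recr/= (le_trans (nuU _ _))//.
  by apply: bigsetU_measurable => i _; exact: mA.
by rewrite lerD2r.
Qed.

Let m_erosion (O : set V) e : measurable (erosion O e).
Proof. by apply: closed_measurable_rV; exact: closed_erosion. Qed.

Let inner (O : set V) : \bar R :=
  ereal_sup [set (nu (erosion O e))%:E | e in [set e | 0 < e]%R].

Let le_inner (O : set V) e : (0 < e)%R -> (nu (erosion O e))%:E <= inner O.
Proof. by move=> e0; apply: ereal_sup_ubound; exists e. Qed.

Let inner_le (O : set V) c :
  (forall e, (0 < e)%R -> (nu (erosion O e))%:E <= c) -> inner O <= c.
Proof. by move=> h; apply: ge_ereal_sup => _ [e e0 <-]; exact: h. Qed.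

Let inner_ge0 (O : set V) : 0 <= inner O.
Proof.
by apply: (le_trans _ (@le_inner O 1%R ltr01)); rewrite lee_fin nu_ge0.
Qed.

Let innerS (O P : set V) : O `<=` P -> inner O <= inner P.
Proof.
move=> OP; apply: inner_le => e e0; apply: le_trans (le_inner _ e0).
by rewrite lee_fin le_nu//; exact: erosionS.
Qed.

Let inner0 : inner set0 = 0.
Proof.
apply/eqP; rewrite eq_le inner_ge0 andbT; apply: inner_le => e e0.
rewrite (_ : erosion set0 e = set0) ?nu0//; rewrite -subset0.
exact: erosion_sub.
Qed.

(** Tightness turns the countable cover into a finite one. Up to mass [r], an erosion of the union
    lies in a compact set [C], and compactness yields a single [n] such that each point of [C] is in
    the erosion of radius [n.+1%:R^-1] of one of the first [n] sets. *)
Let inner_bigcup (F : (set V)^nat) : (forall i, open (F i)) ->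
  inner (\bigcup_i F i) <= \sum_(i <oo) inner (F i).
Proof.
move=> oF; apply: inner_le => e e0; apply/lee_addgt0Pr => r r0.
have [K [cK clK Kr]] := nu_tight r0.
pose C := K `&` erosion (\bigcup_i F i) e.
have /compact_near_coveringP cC : compact C.
  apply: (subclosed_compact _ cK); last by move=> x [].
  by apply: closedI => //; exact: closed_erosion.
have [n _ /(_ n (leqnn n)) Cn] : \forall n \near \oo, forall x, C x ->
    exists2 i, (i < n)%N & erosion (F i) n.+1%:R^-1 x.
  apply: (cC nat \oo
    (fun n x => exists2 i, (i < n)%N & erosion (F i) n.+1%:R^-1 x)).
  move=> x [_ /(erosion_sub e0)[i _ Fix]].
  have /nbhs_ballP[s /= s0 xsF] : nbhs x (F i).
    by apply: open_nbhs_nbhs; split.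
  have s20 : (0 < s / 2)%R by rewrite divr_gt0.
  near=> y n => /=; exists i; first by near: n; exists i.+1.
  move=> z yz; apply: xsF; rewrite (splitr s).
  apply: (@ball_triangle _ _ y).
    by near: y; exact: nbhsx_ballx.
  apply: le_ball yz; apply: ltW.
  by near: n; exact: (near_infty_natSinv_lt (PosNum s20)).
have mU : measurable (\big[setU/set0]_(i < n) erosion (F i) n.+1%:R^-1).
  by apply: bigsetU_measurable => i _; exact: m_erosion.
apply: (@le_trans _ _
  ((\sum_(i < n) nu (erosion (F i) n.+1%:R^-1))%R%:E + r%:E)).
  rewrite -EFinD lee_fin.
  apply: (@le_trans _ _
    (nu (\big[setU/set0]_(i < n) erosion (F i) n.+1%:R^-1 `|` ~` K))).
    apply: le_nu => //.
      apply: measurableU => //; apply: measurableC.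
      exact: closed_measurable_rV.
    move=> x xF; have [Kx|Kx] := pselect (K x); last by right.
    left; have [i ni Fx] := Cn x (conj Kx xF).
    by rewrite -(bigcup_mkord n (fun i => erosion (F i) n.+1%:R^-1)); exists i.
  rewrite (le_trans (nuU _ _))//.
    by apply: measurableC; exact: closed_measurable_rV.
  by rewrite lerD//; exact: (@nu_bigsetU n (fun i => erosion (F i) n.+1%:R^-1)).
rewrite leeD2r// -sumEFin.
apply: le_trans (nneseries_lim_ge n _) => //.
rewrite big_mkord; apply: lee_sum => i _; apply: le_inner.
by rewrite invr_gt0.
Unshelve. all: by end_near. Qed.

Let outer (A : set V) : \bar R :=
  ereal_inf [set inner O | O in [set O | open O /\ A `<=` O]].

Let outer_le (A O : set V) : open O -> A `<=` O -> outer A <= inner O.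
Proof. by move=> oO AO; apply: ereal_inf_lbound; exists O. Qed.

Let le_outer (A : set V) c :
  (forall O, open O -> A `<=` O -> c <= inner O) -> c <= outer A.
Proof. by move=> h; apply: le_ereal_inf_tmp => _ [U [oU AU] <-]; exact: h. Qed.

Let outer_open (O : set V) : open O -> outer O = inner O.
Proof.
move=> oO; apply/eqP; rewrite eq_le outer_le//=.
by apply: le_outer => P oP OP; exact: innerS.
Qed.

Let outer0 : outer set0 = 0.
Proof. by rewrite outer_open ?inner0//; exact: open0. Qed.

Let outer_ge0 A : 0 <= outer A.
Proof. exact: le_outer. Qed.

Let outerS : {homo outer : A B / A `<=` B >-> A <= B}.
Proof.
move=> A B AB; apply: le_outer => O oO BO; apply: outer_le => //.
exact: subset_trans BO.
Qed.

Let nuT_ge (O : set V) : inner O <= (nu setT)%:E.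
Proof. by apply: inner_le => e _; rewrite lee_fin le_nu. Qed.

Let outer_fin A : outer A \is a fin_num.
Proof.
rewrite ge0_fin_numE//; apply: le_lt_trans (ltry (nu setT)).
by apply: le_trans (nuT_ge setT); apply: outer_le => //; exact: openT.
Qed.

Let outer_sigma_subadditive : sigma_subadditive outer.
Proof.
move=> F; apply/lee_addgt0Pr => e e0.
have /choice[G FG] (i : nat) : exists O, [/\ open O, F i `<=` O &
    inner O <= outer (F i) + (e / (2 ^ i.+1)%:R)%:E].
  have ei : (0 < e / (2 ^ i.+1)%:R)%R by rewrite divr_gt0// ltr0n expn_gt0.
  have [_ [U [oU FU] <-] /ltW UF] := lb_ereal_inf_adherent ei (outer_fin (F i)).
  by exists U.
apply: le_trans (epsilon_trick xpredT _ (ltW e0)); last by [].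
apply: (@le_trans _ _ (inner (\bigcup_i G i))).
  apply: outer_le; first by apply: bigcup_open => i _; case: (FG i).
  by apply: subset_bigcup => i _; case: (FG i).
apply: (le_trans (inner_bigcup _)); first by move=> i; case: (FG i).
by apply: lee_nneseries => // i _; case: (FG i).
Qed.

HB.instance Definition _ := isOuterMeasure.Build R V outer
  outer0 outer_ge0 outerS outer_sigma_subadditive.

Let outer_cara (O : set V) : open O -> outer.-caratheodory O.
Proof.
move=> oO; apply: le_caratheodory_measurable => X; apply: le_outer => P oP XP.
apply: (@le_trans _ _ (inner (P `&` O) + outer (P `\` O))).
  apply: leeD; last by apply: outerS => x [/XP].
  by apply: outer_le; [exact: openI|move=> x [/XP]].
rewrite -leeBrDr//; apply: inner_le => e e0.
rewrite leeBrDr// addeC -leeBrDr//.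
(* [C] is closed and contained in [O], so the part of [P] outside [C] is open and contains the part
   of [P] outside [O]. *)
set C := erosion _ e.
have mC : measurable C by exact: m_erosion.
apply: (@le_trans _ _ (inner (P `&` ~` C))).
  apply: outer_le.
    by apply: openI => //; apply: closed_openC; exact: closed_erosion.
  by move=> x [Px Ox]; split=> // /(erosion_sub e0)[].
apply: inner_le => e' e'0; rewrite leeBrDr// -EFinD.
(* [C] and an erosion of the part of [P] outside [C] are disjoint, and both lie in the erosion of
   [P] by the smaller radius, so additivity of [nu] applies. *)
have m0 : (0 < Num.min e e')%R by rewrite lt_min e0.
apply: le_trans (le_inner _ m0); rewrite lee_fin -nu_additive//.
  apply: le_nu => //; first exact: measurableU.
  move=> x [xP|xP]; apply: erosion_anti (erosionS _ xP).
  - by rewrite ge_min lexx orbT.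
  - exact: subIsetl.
  - by rewrite ge_min lexx.
  - exact: subIsetl.
by rewrite -subset0 => x [/(erosion_sub e'0)[_ nC] /nC].
Qed.

Let cara_measurable (A : set V) : measurable A -> outer.-caratheodory A.
Proof.
apply: smallest_sub; [split|by move=> O; exact: outer_cara].
- exact: caratheodory_measurable_set0.
- move=> B mB; rewrite setTD; exact: caratheodory_measurable_setC.
- exact: caratheodory_measurable_bigcup.
Qed.

Let outer_sigma_additive : semi_sigma_additive (outer : set V -> \bar R).
Proof.
move=> F mF tF mUF.
by apply: (@caratheodory_measure_sigma_additive R V outer) => //= [i|];
  exact: cara_measurable.
Qed.

Let outer_measure := outer.

HB.instance Definition _ := isMeasure.Build _ V R outer_measure
  outer0 outer_ge0 outer_sigma_additive.

Lemma charge_regularization : exists rho : {measure set V -> \bar R},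
  rho setT = (nu setT)%:E /\
  forall O, open O -> rho O =
    ereal_sup [set (nu (erosion O e))%:E | e in [set e | 0 < e]%R].
Proof.
exists outer_measure; split; last exact: outer_open.
rewrite [LHS]outer_open; last exact: openT.
(* No mass is lost: every erosion of the whole space is the whole space, so radius 1 will do. *)
apply/eqP; rewrite eq_le nuT_ge/=; apply: le_trans (le_inner _ ltr01).
by rewrite lee_fin le_nu// => x _ y.
Qed.

End regularization.

(** * Ultralimits of tight sequences of measures *)

Lemma compact_norm_le (R : realType) N (r : R) :
  compact [set x : 'rV[R]_N | `|x| <= r].
Proof.
apply: bounded_closed_compact.
  exists r; split; first exact: num_real.
  by move=> M rM x /= /le_trans; apply; exact: ltW.
apply: (@closed_comp _ _ (fun x : 'rV[R]_N => `|x|) [set y | y <= r]).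
  by move=> x _; exact: norm_continuous.
exact: closed_le.
Qed.

(** Compactness of the segment gives a cluster point [l]. For an ultrafilter it is a limit: if the
    preimage of a neighbourhood of [l] were not in [U], the preimage of its complement would be, and
    [l] could not be a cluster point. *)
Lemma cvg_ultra_bounded (R : realType) (U : set_system nat) (u : nat -> R) a b :
  UltraFilter U -> (forall k, a <= u k <= b) -> cvg (u @ U).
Proof.
move=> UU uab; have PU : ProperFilter U by exact: ultra_proper.
have uU : (u @ U) `[a, b]%classic.
  by apply: (@filterE _ U) => k; rewrite /= in_itv; exact: uab.
have [l [_ ul]] := segment_compact _ uU.
apply/cvg_ex; exists l => A /= lA.
have [//|UA] := in_ultra_setVsetC (u @^-1` A) UU.
by have [x []] := ul (~` A) A UA lA.
Qed.

Section tight_limit.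
Context (R : realType) (N : nat).
Local Notation V := 'rV[R]_N.
Context (mu : nat -> {measure set V -> \bar R}) (p : R)
  (mu_mass : forall k, mu k setT = p%:E)
  (mu_tight : forall e, 0 < e ->
    exists r, forall k, (mu k [set x | (r < `|x|)%R] <= e%:E)%E).

Let mu_le k A : measurable A -> (mu k A <= p%:E)%E.
Proof. by move=> mA; rewrite -(mu_mass k) le_measure ?inE. Qed.

Let mu_fin k A : measurable A -> mu k A \is a fin_num.
Proof.
move=> mA; rewrite ge0_fin_numE//; apply: le_lt_trans (ltry p).
exact: mu_le.
Qed.

(** Along an ultrafilter finer than [\oo] the masses of every measurable set converge; the limits
    are finitely additive, and [charge_regularization] makes a measure of them. The bound involves
    an erosion of [O], not just [O], so that points may still be moved by less than [d]; the gluing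
    relies on this. *)
Lemma tight_limit :
  exists (U : set_system nat) (rho : {measure set V -> \bar R}),
  [/\ ProperFilter U, U --> \oo, rho setT = p%:E &
      forall (O : set V) e, open O -> 0 < e -> exists2 d, 0 < d &
        \forall k \near U, (rho O <= mu k (erosion O d) + e%:E)%E].
Proof.
have [U [UU oU]] := ultraFilterLemma eventually_filter.
have PU : ProperFilter U by exact: ultra_proper.
pose u A k := fine (mu k A).
pose nu A := lim (u A @ U).
have u_itv A k : measurable A -> 0 <= u A k <= p.
  by move=> mA; rewrite fine_ge0//= -lee_fin fineK ?mu_le// mu_fin.
have u_cvg A : measurable A -> u A @ U --> nu A.
  by move=> mA; apply: (@cvg_ultra_bounded _ _ _ 0 p) => k; exact: u_itv.
have nu_additive A B : measurable A -> measurable B -> A `&` B = set0 ->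
    nu (A `|` B) = nu A + nu B.
  move=> mA mB AB; rewrite /nu (_ : u (A `|` B) = u A \+ u B).
    by apply/cvg_lim => //; apply: cvgD; exact: u_cvg.
  by apply/funext => k; rewrite /u measureU// fineD ?mu_fin.
have nu_ge0 A : measurable A -> 0 <= nu A.
  move=> mA; apply: limr_ge; first exact: (cvgP _ (u_cvg _ mA)).
  by apply: nearW => k; case/andP: (u_itv A k mA).
have nu_tight e : 0 < e -> exists K, [/\ compact K, closed K & nu (~` K) <= e].
  move=> e0; have [r mur] := mu_tight e0.
  exists [set x | `|x| <= r]; split.
  - exact: compact_norm_le.
  - apply: compact_closed; first exact: norm_hausdorff.
    exact: compact_norm_le.
  - rewrite (_ : ~` _ = [set x | r < `|x|]); last first.
      by apply/seteqP; split=> x /=; rewrite ltNge => /negP.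
    have mr : measurable [set x : V | r < `|x|].
      apply: open_measurable_rV.
      apply: (@open_comp _ _ (fun x : V => `|x|) [set y | r < y]).
        by move=> x _; exact: norm_continuous.
      exact: open_gt.
    apply: limr_le; first exact: (cvgP _ (u_cvg _ mr)).
    by apply: nearW => k; rewrite -lee_fin fineK ?mur// mu_fin.
have [rho [rhoT rhoO]] := charge_regularization nu_additive nu_ge0 nu_tight.
have nuT : nu setT = p.
  apply/cvg_lim => //; rewrite (_ : u setT = fun=> p); first exact: cvg_cst.
  by apply/funext => k; rewrite /u mu_mass.
exists U, rho; split => //; first by rewrite rhoT nuT.
move=> A e oA e0.
have rhofin : rho A \is a fin_num.
  rewrite ge0_fin_numE//; apply: le_lt_trans (ltry p).
  by rewrite -nuT -rhoT le_measure ?inE//; exact: open_measurable_rV.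
(* One half of [e] pays for replacing [O] by an erosion, the other for replacing the limit [nu] by
   [mu k]. *)
have e20 : 0 < e / 2 by rewrite divr_gt0.
have [_ [d d0 <-]] := ub_ereal_sup_adherent e20
  (etrans (esym (congr1 _ (rhoO _ oA))) rhofin).
rewrite -rhoO// => rhod; exists d => //.
have mE : measurable (erosion A d).
  rewrite -(setCK (erosion A d)); apply: measurableC; apply: open_measurable_rV.
  by apply: closed_openC; exact: closed_erosion.
near=> k.
have : nu (erosion A d) - e / 2 < u (erosion A d) k.
  by near: k; apply: cvgr_gt (u_cvg _ mE) _ _; rewrite ltrBlDr ltrDl.
rewrite -lte_fin fineK ?mu_fin// EFinB lteBlDr//.
rewrite lteBlDr// in rhod => h.
rewrite [in leRHS](splitr e) EFinD addeA ltW// (lt_trans rhod)//.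
by rewrite lteD2rE.
Unshelve. all: by end_near. Qed.

End tight_limit.

(** The portmanteau inequality on open sets, sufficient wherever no point has to be moved. *)
Lemma near_le_of_erosion (R : realType) N (U : set_system nat)
    (mu : nat -> {measure set 'rV[R]_N -> \bar R})
    (rho : {measure set 'rV[R]_N -> \bar R}) : ProperFilter U ->
  (forall (O : set 'rV[R]_N) e, open O -> 0 < e -> exists2 d, 0 < d &
    \forall k \near U, (rho O <= mu k (erosion O d) + e%:E)%E) ->
  forall (O : set 'rV[R]_N) e, open O -> 0 < e ->
    \forall k \near U, (rho O <= mu k O + e%:E)%E.
Proof.
move=> PU rhoO A e oA e0; have [r r0 rhor] := rhoO A e oA e0.
apply: filterS rhor => k /le_trans; apply; rewrite leeD2r// le_measure ?inE//.
- exact: (closed_measurable_rV (@closed_erosion _ _ _ _)).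
- exact: open_measurable_rV.
- exact: erosion_sub.
Qed.

Lemma bigcup_erosion (R : realType) N (O : set 'rV[R]_N) :
  open O -> \bigcup_n erosion O n.+1%:R^-1 = O.
Proof.
move=> oO; apply/seteqP; split=> [x [n _]|x Ox].
  by apply: erosion_sub; rewrite invr_gt0.
have /nbhs_ballP[e /= e0 xeO] : nbhs x O by apply: open_nbhs_nbhs; split.
have [n _ /(_ n (leqnn n)) ne] := near_infty_natSinv_lt (PosNum e0).
exists n => //; apply: subset_trans xeO; apply: le_ball; exact: ltW.
Qed.

(** Erosions are closed, so the inequality holds on their open complements; as the total masses
    agree, it is reversed on the erosions, and hence on [O], which they exhaust. Open sets are
    stable under intersection and generate the sigma-algebra. *)
Lemma same_measure_open (R : realType) N
    (mu nu : {measure set 'rV[R]_N -> \bar R}) (p : R) :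
  mu setT = p%:E -> nu setT = p%:E ->
  (forall O, open O -> (mu O <= nu O)%E) -> same_measure mu nu.
Proof.
move=> muT nuT munu.
have munuO O : open O -> mu O = nu O.
  move=> oO; apply/eqP; rewrite eq_le munu//=.
  pose F n := erosion O n.+1%:R^-1.
  have mF n : measurable (F n).
    by apply: closed_measurable_rV; exact: closed_erosion.
  have F_nd : {homo F : n m / (n <= m)%N >-> (n <= m)%O}.
    move=> m n mn; apply/subsetPset; apply: erosion_anti.
    by rewrite lef_pV2 ?posrE// ler_nat ltnS.
  have mUF : measurable (\bigcup_n F n) by exact: bigcup_measurable.
  have := @nondecreasing_cvg_mu _ _ _ nu _ mF mUF F_nd.
  have := @nondecreasing_cvg_mu _ _ _ mu _ mF mUF F_nd.
  rewrite bigcup_erosion// => muF nuF.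
  rewrite -(cvg_lim _ muF)// -(cvg_lim _ nuF)//.
  apply: lee_lim; [exact: (cvgP _ nuF)|exact: (cvgP _ muF)|].
  apply: nearW => n /=.
  have muC (m : {measure set 'rV[R]_N -> \bar R}) : m setT = p%:E ->
      (m (F n) = p%:E - m (~` F n))%E.
    move=> mT; rewrite -mT -(setUv (F n)) measureU ?setICr//; last first.
      exact: measurableC.
    rewrite addeK// ge0_fin_numE//; apply: le_lt_trans (ltry p).
    by rewrite -mT le_measure ?inE//; exact: measurableC.
  rewrite !muC// leeB// munu//; apply: closed_openC.
  exact: closed_erosion.
move=> A mA.
apply: (@measure_unique _ R 'rV[R]_N open (fun=> setT)
  _ _ _ _ mu nu _ _ A mA) => //.
- exact: openI.
- by move=> _; exact: openT.
- by rewrite bigcup_const.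
- by move=> _; rewrite muT ltry.
Qed.

(** * Lower semicontinuity of integrals of nonnegative continuous functions *)

Section staircase.
Context (R : realType) (T : Type) (c : T -> R).

(* A lower approximation of [c], up to [h] below the level [M * h], by a
   combination of superlevel sets. *)
Definition staircase (h : R) (M : nat) (x : T) : R :=
  \sum_(j < M) h * \1_[set y | j.+1%:R * h < c y] x.

Lemma staircase_full h M x : 0 < h -> M%:R * h < c x ->
  staircase h M x = M%:R * h.
Proof.
move=> h0 Mh; rewrite /staircase (eq_bigr (fun=> h)).
  by rewrite sumr_const card_ord mulr_natl.
move=> j _; rewrite indicE mem_set ?mulr1//=.
by apply: le_lt_trans Mh; rewrite ler_pM2r// ler_nat.
Qed.

Lemma staircaseS h M x : staircase h M.+1 x =
  staircase h M x + h * \1_[set y | M.+1%:R * h < c y] x.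
Proof. by rewrite /staircase big_ord_recr. Qed.

Lemma staircase_ge0 h M x : 0 <= h -> 0 <= staircase h M x.
Proof. by move=> h0; apply: sumr_ge0 => j _; rewrite mulr_ge0. Qed.

Lemma staircase_le h M x : 0 < h -> 0 <= c x -> staircase h M x <= c x.
Proof.
move=> h0 c0; elim: M => [|M ih]; first by rewrite /staircase big_ord0.
have [Mh|Mh] := ltP (M.+1%:R * h) (c x).
  by rewrite staircase_full// ltW.
rewrite staircaseS indicE memNset ?mulr0 ?addr0//=.
by apply/negP; rewrite -leNgt.
Qed.

Lemma staircase_ge h M x : 0 < h -> c x <= M.+1%:R * h ->
  c x - h <= staircase h M x.
Proof.
move=> h0; elim: M => [|M ih] cM.
  by rewrite /staircase big_ord0 subr_le0; rewrite mul1r in cM.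
have [Mh|Mh] := ltP (M.+1%:R * h) (c x).
  by rewrite staircase_full// lerBlDr; move: cM; rewrite -natr1 mulrDl mul1r.
rewrite staircaseS indicE memNset ?mulr0 ?addr0 ?ih//=.
by apply/negP; rewrite -leNgt.
Qed.

(** The [n.+1 ^ 2] steps of height [n.+1%:R^-1] reach level [n.+1], which exceeds [c x] for large
    [n]; from then on the error is at most one step. *)
Lemma cvg_staircase x : 0 <= c x ->
  staircase n.+1%:R^-1 (n.+1 ^ 2) x @[n --> \oo] --> c x.
Proof.
move=> c0; apply/cvgrPdist_le => e e0; near=> n.
have n0 : 0 < n.+1%:R^-1 :> R by rewrite invr_gt0.
rewrite ger0_norm ?subr_ge0 ?staircase_le//.
apply: (@le_trans _ _ n.+1%:R^-1); last first.
  by near: n; apply: filterS (near_infty_natSinv_lt (PosNum e0)) => n /ltW.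
rewrite lerBlDl -lerBlDr staircase_ge//.
apply: (@le_trans _ _ n.+1%:R).
  near: n; exists (Num.truncn (c x)) => // n /= cn.
  by rewrite ltW// (lt_le_trans (truncnS_gt _))// ler_nat ltnS.
rewrite -[(n.+1 ^ 2).+1%:R]natr1 natrX mulrDl expr2 mulfK ?pnatr_eq0//.
by rewrite lerDl mul1r ltW.
Unshelve. all: by end_near. Qed.

End staircase.

Section lsc.
Context (R : realType) (N : nat).
Local Notation V := 'rV[R]_N.
Local Open Scope ereal_scope.

Lemma integral_staircase (mu : {measure set V -> \bar R}) (c : V -> R) h M :
  continuous c -> (0 <= h)%R ->
  \int[mu]_x (staircase c h M x)%:E =
  \sum_(j < M) h%:E * mu [set y | j.+1%:R * h < c y]%R.
Proof.
move=> cc h0; rewrite /staircase.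
have mO (j : 'I_M) : measurable [set y | j.+1%:R * h < c y]%R.
  apply: open_measurable_rV.
  apply: (@open_comp _ _ c [set y | j.+1%:R * h < y]%R).
    by move=> x _; exact: cc.
  exact: open_gt.
under eq_integral do rewrite -sumEFin.
rewrite ge0_integral_sum//.
- apply: eq_bigr => j _; under eq_integral do rewrite EFinM.
  rewrite ge0_integralZl_EFin//.
  + by rewrite integral_indic// setIT.
  + by apply/measurable_EFinP; exact: measurable_indic.
- by move=> j; apply/measurable_EFinP; apply: measurable_funM => //;
    exact: measurable_indic.
- by move=> j x _; rewrite lee_fin mulr_ge0.
Qed.

Lemma continuous_measurable_rV (c : V -> R) :
  continuous c -> measurable_fun setT c.
Proof.
move=> cc; apply: (measurability _ (RGenOpens.measurableE R)).
move=> _ [_ [a [b ->]] <-]; rewrite setTI; apply: open_measurable_rV.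
by apply: open_comp => [x _|]; [exact: cc|exact: interval_open].
Qed.

(** The integral of a staircase is a finite combination of masses of open superlevel sets, to which
    the bound on open sets applies. Fatou's lemma passes from the staircases to [c]. *)
Lemma le_integral_lsc (U : set_system nat)
    (mu : nat -> {measure set V -> \bar R})
    (rho : {measure set V -> \bar R}) (c : V -> R) (L : R) :
  ProperFilter U ->
  (forall (O : set V) e, open O -> (0 < e)%R ->
    \forall k \near U, rho O <= mu k O + e%:E) ->
  continuous c -> (forall x, 0 <= c x)%R ->
  (forall e, (0 < e)%R ->
    \forall k \near U, \int[mu k]_x (c x)%:E <= (L + e)%:E) ->
  \int[rho]_x (c x)%:E <= L%:E.
Proof.
move=> PU rhoO cc c0 muL.
have mc := continuous_measurable_rV cc.
have mst h M : measurable_fun setT (staircase c h M).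
  apply: measurable_sum => j; apply: measurable_funM => //.
  apply: measurable_indic; rewrite -[X in measurable X]setTI.
  by apply: measurable_fun_ltr => //; exact: measurable_cst.
have st_le h M : (0 < h)%R -> \int[rho]_x (staircase c h M x)%:E <= L%:E.
  move=> h0; apply/lee_addgt0Pr => e e0.
  (* The [M] errors [e'], each weighted by [h], add up to at most [e / 2]; the added 1 keeps the
     denominator positive for [M = 0]. *)
  pose e' := (e / 2 / (M%:R * h + 1))%R.
  have Mh : (0 < M%:R * h + 1)%R by rewrite ltr_wpDl// mulr_ge0// ltW.
  have e'0 : (0 < e')%R by rewrite !divr_gt0.
  have e20 : (0 < e / 2)%R by rewrite divr_gt0.
  have : \forall k \near U, forall j : 'I_M,
      rho [set y | j.+1%:R * h < c y]%R <=
      mu k [set y | j.+1%:R * h < c y]%R + e'%:E.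
    apply: filter_forall => j; apply: rhoO => //.
    apply: (@open_comp _ _ c [set y | j.+1%:R * h < y]%R).
      by move=> x _; exact: cc.
    exact: open_gt.
  move=> /(filterI (muL _ e20)) /filter_ex[k [muk rhok]].
  rewrite (integral_staircase _ _ cc (ltW h0)).
  apply: (@le_trans _ _ (\sum_(j < M) h%:E *
    (mu k [set y | j.+1%:R * h < c y]%R + e'%:E))).
    by apply: lee_sum => j _; rewrite lee_wpmul2l// lee_fin (ltW h0).
  under eq_bigr do rewrite ge0_muleDr ?lee_fin ?(ltW e'0)//.
  rewrite big_split/= -(integral_staircase _ _ cc (ltW h0)).
  rewrite sumEFin sumr_const card_ord [in leRHS](splitr e) EFinD addeA.
  apply: leeD.
    apply: le_trans muk; apply: ge0_le_integral => //.
    - by move=> x _; rewrite lee_fin staircase_ge0// ltW.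
    - exact/measurable_EFinP.
    - exact/measurable_EFinP.
    - by move=> x _; rewrite lee_fin staircase_le.
  rewrite lee_fin -[leLHS]mulr_natl mulrA /e' mulrA ler_pdivrMr//.
  by rewrite [leLHS]mulrC ler_wpM2l ?(ltW e20)// lerDl.
have fL := @fatou _ _ _ rho setT measurableT
  (fun n x => (staircase c n.+1%:R^-1 (n.+1 ^ 2) x)%:E).
have -> : \int[rho]_x (c x)%:E = \int[rho]_x limn_einf
    (fun n => (staircase c n.+1%:R^-1 (n.+1 ^ 2) x)%:E).
  apply: eq_integral => x _; apply/esym.
  apply: (@cvg_limn_einf_sup _ _ _ _).1.
  by apply/fine_cvgP; split; [exact: nearW|exact: cvg_staircase].
apply: (le_trans (fL _ _)).
- by move=> n; apply/measurable_EFinP.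
- by move=> n x _; rewrite lee_fin staircase_ge0.
(* The lower limit is the limit of the tail infima, each at most the first term of its tail. *)
rewrite limn_einf_lim; apply: lime_le; first exact: is_cvg_einfs.
apply: nearW => n; apply: (@le_trans _ _
  (\int[rho]_x (staircase c n.+1%:R^-1 (n.+1 ^ 2) x)%:E)).
  by apply: ereal_inf_lbound; exists n => //=.
by apply: st_le; rewrite invr_gt0.
Qed.

End lsc.

(** * Euclidean space as a product *)

Section finite_measure_of.
Context d (T : measurableType d) (R : realType).
Context (mu : {measure set T -> \bar R}) (p : R).

(** This is [mu] itself, indexed by a proof that its total mass is [p], so that it can carry the
    structure of a finite measure required by product measures and Fubini's theorem. *)
Definition finite_measure_of (_ : mu setT = p%:E) : set T -> \bar R := mu.

Context (muT : mu setT = p%:E).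
Local Notation nu := (finite_measure_of muT).

Let nu0 : nu set0 = 0%E. Proof. exact: measure0. Qed.

Let nu_ge0 A : (0 <= nu A)%E. Proof. exact: measure_ge0. Qed.

Let nu_sigma_additive : semi_sigma_additive nu.
Proof. exact: measure_semi_sigma_additive. Qed.

HB.instance Definition _ :=
  isMeasure.Build _ _ _ nu nu0 nu_ge0 nu_sigma_additive.

Let nu_fin : fin_num_fun nu.
Proof. by apply: lty_fin_num_fun; rewrite /finite_measure_of muT ltry. Qed.

HB.instance Definition _ := Measure_isFinite.Build _ _ _ nu nu_fin.

End finite_measure_of.

Section rV_norm.
Context (R : realType).

Lemma rV_coord_le N (x : 'rV[R]_N) k : `|x 0 k| <= `|x|.
Proof.
rewrite [leRHS]/Num.norm/= mx_normrE; apply/bigmax_geP; right => /=.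
by exists (0, k).
Qed.

Lemma rV_norm_le N (x : 'rV[R]_N) r :
  0 <= r -> (forall k, `|x 0 k| <= r) -> `|x| <= r.
Proof.
move=> r0 xr; rewrite [leLHS]/Num.norm/= mx_normrE.
apply/bigmax_leP; split=> //.
by move=> [i j] _ /=; rewrite (ord1 i).
Qed.

Lemma norm_row_mx_le N1 N2 (x : 'rV[R]_N1) (y : 'rV[R]_N2) r :
  `|x| <= r -> `|y| <= r -> `|row_mx x y| <= r.
Proof.
move=> xr yr; apply: rV_norm_le; first exact: le_trans xr.
move=> k; rewrite mxE; case: splitP => j _.
  by apply: le_trans xr; exact: rV_coord_le.
by apply: le_trans yr; exact: rV_coord_le.
Qed.

Lemma ball_row_mx N1 N2 (x x' : 'rV[R]_N1) (y y' : 'rV[R]_N2) e :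
  ball x e x' -> ball y e y' -> ball (row_mx x y) e (row_mx x' y').
Proof.
move=> [e0 xx'] [_ yy']; split=> // i k; rewrite !mxE.
by case: splitP => j _; [exact: xx'|exact: yy'].
Qed.

Lemma continuous_lsubmx N1 N2 : continuous (@lsubmx R 1 N1 N2).
Proof.
move=> x A /nbhs_ballP[e /= e0 eA]; apply/nbhs_ballP; exists e => //= y [_ xy].
by apply: eA; split=> // i j; rewrite !mxE; exact: xy.
Qed.

Lemma continuous_rsubmx N1 N2 : continuous (@rsubmx R 1 N1 N2).
Proof.
move=> x A /nbhs_ballP[e /= e0 eA]; apply/nbhs_ballP; exists e => //= y [_ xy].
by apply: eA; split=> // i j; rewrite !mxE; exact: xy.
Qed.

Lemma continuous_sqnorm N : continuous (@sqnorm R N).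
Proof.
apply: continuous_big => [|k _ x]; first exact: add_continuous.
have xk : continuous (fun y : 'rV[R]_N => y 0 k : R).
  by move=> y; exact: coord_continuous.
exact: (cvgM (xk x) (xk x)).
Qed.

Lemma measurable_sqnorm N : measurable_fun setT (@sqnorm R N).
Proof. exact: (continuous_measurable_rV (@continuous_sqnorm N)). Qed.

Lemma sqnorm_ge0 N (x : 'rV[R]_N) : 0 <= sqnorm x.
Proof. by apply: sumr_ge0 => k _; exact: sqr_ge0. Qed.

Lemma measurable_row_mx d (T : measurableType d) N1 N2
    (f : T -> 'rV[R]_N1) (g : T -> 'rV[R]_N2) :
  measurable_fun setT f -> measurable_fun setT g ->
  measurable_fun setT (fun t => row_mx (f t) (g t)).
Proof.
move=> /measurable_fun_rVP mf /measurable_fun_rVP mg.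
apply/measurable_fun_rVP => k.
under eq_fun do rewrite mxE.
by case: (fintype.split k) => j; [exact: mf|exact: mg].
Qed.

Lemma measurable_lsubmx N1 N2 : measurable_fun setT (@lsubmx R 1 N1 N2).
Proof.
apply/measurable_fun_rVP => k; under eq_fun do rewrite mxE.
exact: measurable_coord.
Qed.

Lemma measurable_rsubmx N1 N2 : measurable_fun setT (@rsubmx R 1 N1 N2).
Proof.
apply/measurable_fun_rVP => k; under eq_fun do rewrite mxE.
exact: measurable_coord.
Qed.

HB.instance Definition _ N1 N2 :=
  isMeasurableFun.Build _ _ _ _ (@lsubmx R 1 N1 N2) (@measurable_lsubmx N1 N2).
HB.instance Definition _ N1 N2 :=
  isMeasurableFun.Build _ _ _ _ (@rsubmx R 1 N1 N2) (@measurable_rsubmx N1 N2).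

(** Carries measures on a product over to row vectors, the setting of [tight_limit]; [split_pair]
    carries the limit back. *)
Definition join_pair N1 N2 (z : 'rV[R]_N1 * 'rV[R]_N2) : 'rV[R]_(N1 + N2) :=
  row_mx z.1 z.2.

Definition split_pair N1 N2 (x : 'rV[R]_(N1 + N2)) : 'rV[R]_N1 * 'rV[R]_N2 :=
  (lsubmx x, rsubmx x).

Lemma join_pairK N1 N2 : cancel (@join_pair N1 N2) (@split_pair N1 N2).
Proof. by case=> x y; rewrite /split_pair row_mxKl row_mxKr. Qed.

Let measurable_join_pair N1 N2 : measurable_fun setT (@join_pair N1 N2).
Proof.
by apply: measurable_row_mx; [exact: measurable_fst|exact: measurable_snd].
Qed.

Let measurable_split_pair N1 N2 : measurable_fun setT (@split_pair N1 N2).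
Proof.
apply: measurable_fun_pair; first exact: measurable_lsubmx.
exact: measurable_rsubmx.
Qed.

HB.instance Definition _ N1 N2 := isMeasurableFun.Build _ _ _ _
  (@join_pair N1 N2) (@measurable_join_pair N1 N2).
HB.instance Definition _ N1 N2 := isMeasurableFun.Build _ _ _ _
  (@split_pair N1 N2) (@measurable_split_pair N1 N2).

Lemma open_norm_gt N (r : R) : open [set x : 'rV[R]_N | r < `|x|].
Proof.
apply: (@open_comp _ _ (fun x : 'rV[R]_N => `|x|) [set y | r < y]).
  by move=> x _; exact: norm_continuous.
exact: open_gt.
Qed.

(** Continuity from above along the sets where the norm exceeds [n], which have empty intersection.
    All larger radii are included so that the radii of several measures can be merged by a
    maximum. *)
Lemma measure_tight N (mu : {measure set 'rV[R]_N -> \bar R}) p e :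
  mu setT = p%:E -> 0 < e ->
  exists r, forall r', r <= r' -> (mu [set x | (r' < `|x|)%R] <= e%:E)%E.
Proof.
move=> muT e0.
pose F n := [set x : 'rV[R]_N | n%:R < `|x|].
have mF n : measurable (F n) by apply: open_measurable_rV; exact: open_norm_gt.
have F0 : \bigcap_n F n = set0.
  rewrite -subset0 => x /(_ (Num.truncn `|x|).+1 I) /=.
  by rewrite /F/= ltNge => /negP; apply; rewrite ltW// truncnS_gt.
have muF : mu \o F @ \oo --> mu (\bigcap_n F n).
  apply: nonincreasing_cvg_mu => //.
  - by rewrite (@le_lt_trans _ _ (mu setT)) ?muT ?ltry// -muT le_measure ?inE.
  - by rewrite F0.
  - move=> m n mn; apply/subsetPset => x /=; apply: le_lt_trans.
    by rewrite ler_nat.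
rewrite F0 measure0 in muF.
have [n _ /(_ n (leqnn n)) /= muFn] :
    \forall n \near \oo, ((mu \o F) n < e%:E)%E.
  have /fine_cvgP[Ffin F_cvg] := muF.
  near=> n; rewrite -[ltLHS]fineK; last by near: n.
  by rewrite lte_fin; near: n; exact: (cvgr_lt _ F_cvg).
exists n%:R => r nr; apply: le_trans (ltW muFn).
rewrite le_measure ?inE//.
  exact: (open_measurable_rV (@open_norm_gt _ _)).
by move=> x /=; exact: le_lt_trans.
Unshelve. all: by end_near. Qed.

End rV_norm.

(** * Optimal couplings *)

(** Keeps marginal constraints in the limit: preimages of open sets under [f] are open and have the
    same mass for all [k], so the image of [rho] is at most [al] on open sets, and
    [same_measure_open] gives equality. *)
Lemma same_measure_limit (R : realType) N1 N2 (U : set_system nat)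
    (mu : nat -> {measure set 'rV[R]_N1 -> \bar R})
    (rho : {measure set 'rV[R]_N1 -> \bar R})
    (f : {mfun 'rV[R]_N1 >-> 'rV[R]_N2})
    (al : {measure set 'rV[R]_N2 -> \bar R}) (p : R) :
  ProperFilter U -> continuous f ->
  (forall O e, open O -> 0 < e ->
    \forall k \near U, (rho O <= mu k O + e%:E)%E) ->
  rho setT = p%:E -> al setT = p%:E ->
  (forall k A, measurable A -> mu k (f @^-1` A) = al A) ->
  same_measure (image_measure rho f) al.
Proof.
move=> PU cf rhoO rhoT alT muf.
apply: (@same_measure_open _ _ (image_measure rho f) al p) => //.
move=> A oA; apply/lee_addgt0Pr => e e0.
have oB : open (f @^-1` A) by apply: open_comp => // x _; exact: cf.
have [k rhok] := filter_ex (rhoO _ _ oB e0).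
by apply: le_trans rhok _; rewrite muf//; exact: open_measurable_rV.
Qed.

Section optimal_coupling.
Context (R : realType) (d : nat).
Local Notation V := 'rV[R]_d.
Context (al be : {measure set V -> \bar R}) (p : R) (p0 : 0 < p)
  (alT : al setT = p%:E) (beT : be setT = p%:E).
Local Open Scope ereal_scope.

(** The product of [al] and [be] has marginals [p] times too large, so it is scaled by [p^-1]. *)
Lemma coupling_exists : exists ga, couplings al be ga.
Proof.
pose be' : {finite_measure set V -> \bar R} := finite_measure_of beT.
have pV0 : (0 <= p^-1)%R by rewrite invr_ge0 ltW.
exists (mscale (NngNum pV0) (al \x be')); split=> A mA.
- transitivity (p^-1%:E * (al \x be') (fst @^-1` A)); first by [].
  rewrite (_ : fst @^-1` A = A `*` setT); last first.
    by apply/seteqP; split=> -[x y] //= [].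
  rewrite product_measure1E//= /finite_measure_of beT muleCA -EFinM.
  by rewrite mulVf ?mule1 ?gt_eqF.
- transitivity (p^-1%:E * (al \x be') (snd @^-1` A)); first by [].
  rewrite (_ : snd @^-1` A = setT `*` A); last first.
    by apply/seteqP; split=> -[x y] //= [].
  rewrite product_measure1E//= /finite_measure_of alT muleA -EFinM.
  by rewrite mulVf ?mul1e ?gt_eqF.
Qed.

Lemma coupling_mass ga : couplings al be ga -> ga setT = p%:E.
Proof. by move=> [/(_ setT measurableT)]; rewrite alT. Qed.

Lemma measurable_cost :
  measurable_fun setT (fun z : V * V => (sqnorm (z.1 - z.2))%:E).
Proof.
apply/measurable_EFinP; apply: (measurableT_comp (@measurable_sqnorm R d)).
apply/measurable_fun_rVP => k; under eq_fun do rewrite !mxE.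
by apply: measurable_funB; apply: (measurableT_comp (measurable_coord k));
  [exact: measurable_fst|exact: measurable_snd].
Qed.

(** If the joined vector has norm above [r], so does one of its halves. The resulting bound depends
    only on the marginals, hence one radius serves the whole sequence. *)
Lemma coupling_join_tight (ga : nat -> {measure set (V * V) -> \bar R}) e :
  (forall k, couplings al be (ga k)) -> (0 < e)%R -> exists r, forall k,
    image_measure (ga k) (@join_pair R d d) [set x | (r < `|x|)%R] <= e%:E.
Proof.
move=> gac e0; have e20 : (0 < e / 2)%R by rewrite divr_gt0.
have [r1 alr] := measure_tight alT e20; have [r2 ber] := measure_tight beT e20.
pose r := Num.max r1 r2.
have mr : measurable [set x : V | (r < `|x|)%R].
  exact: (open_measurable_rV (@open_norm_gt _ _ _)).
exists r => k; have [gaal gabe] := gac k.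
rewrite (splitr e) EFinD; apply: le_trans (leeD (alr r _) (ber r _)).
- rewrite -gaal// -gabe// /image_measure /pushforward.
  have mfst : measurable (@fst V V @^-1` [set x | (r < `|x|)%R]).
    by rewrite -[X in measurable X]setTI; exact: measurable_fst.
  have msnd : measurable (@snd V V @^-1` [set x | (r < `|x|)%R]).
    by rewrite -[X in measurable X]setTI; exact: measurable_snd.
  apply: le_trans (measureU2 (ga k) mfst msnd).
  rewrite le_measure ?inE//.
  + apply: measurable_funPTI; exact: (open_measurable_rV (@open_norm_gt _ _ _)).
  + exact: measurableU.
  + move=> [x y]; rewrite /join_pair/= => xy; apply: contrapT.
    move=> /not_orP[/negP + /negP]; rewrite -!leNgt => xr yr.
    by have := norm_row_mx_le xr yr; rewrite leNgt xy.
- by rewrite le_max lexx.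
- by rewrite le_max lexx orbT.
Qed.

Lemma optimal_coupling_exists : exists ga, optimal_coupling al be ga.
Proof.
pose costs := [set transport_cost ga | ga in couplings al be].
have inf_ge0 : 0 <= ereal_inf costs.
  apply: le_ereal_inf_tmp => _ [ga _ <-]; apply: integral_ge0 => z _.
  by rewrite lee_fin sqnorm_ge0.
(* If the infimum is infinite, every coupling is optimal. *)
have [infy|inf_fin] := eqVneq (ereal_inf costs) +oo.
  have [ga gac] := coupling_exists; exists ga; split=> // ga' ga'c.
  have -> : transport_cost ga' = +oo; last exact: leey.
  by apply/eqP; rewrite -leye_eq -infy; apply: ereal_inf_lbound; exists ga'.
have {}inf_fin : ereal_inf costs \is a fin_num.
  by rewrite ge0_fin_numE// lt_neqAle inf_fin leey.
pose L := fine (ereal_inf costs).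
have /choice[ga gaP] k : exists ga, couplings al be ga /\
    transport_cost ga <= (L + k.+1%:R^-1)%:E.
  have k0 : (0 < k.+1%:R^-1 :> R)%R by rewrite invr_gt0.
  have [_ [ga gac <-] gak] := lb_ereal_inf_adherent k0 inf_fin.
  by exists ga; split=> //; rewrite EFinD /L fineK// ltW.
pose mu k : {measure set 'rV[R]_(d + d) -> \bar R} :=
  image_measure (ga k) (@join_pair R d d).
have muT k : mu k setT = p%:E by exact: coupling_mass (gaP k).1.
have [U [rho [PU Uoo rhoT rhoO]]] := tight_limit muT
  (fun e e0 => coupling_join_tight (fun k => (gaP k).1) e0).
have {}rhoO := near_le_of_erosion PU rhoO.
pose ga0 : {measure set (V * V) -> \bar R} :=
  image_measure rho (@split_pair R d d).
exists ga0; split.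
  split.
  - apply: (same_measure_limit (f := @lsubmx R 1 d d) PU _ rhoO rhoT alT).
      exact: continuous_lsubmx.
    move=> k A mA; have [gaal _] := (gaP k).1; rewrite -gaal//.
    rewrite /mu /image_measure /pushforward; congr (ga k _).
    by apply/seteqP; split => -[x y]; rewrite /join_pair/= row_mxKl.
  - apply: (same_measure_limit (f := @rsubmx R 1 d d) PU _ rhoO rhoT beT).
      exact: continuous_rsubmx.
    move=> k A mA; have [_ gabe] := (gaP k).1; rewrite -gabe//.
    rewrite /mu /image_measure /pushforward; congr (ga k _).
    by apply/seteqP; split => -[x y]; rewrite /join_pair/= row_mxKr.
move=> ga' ga'c; apply: (@le_trans _ _ (ereal_inf costs)); last first.
  by apply: ereal_inf_lbound; exists ga'.
rewrite -(fineK inf_fin) -/L /transport_cost.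
rewrite ge0_integral_pushforward//; last 2 first.
  - exact: measurable_cost.
  - by move=> z _; rewrite lee_fin sqnorm_ge0.
rewrite preimage_setT.
apply: (le_integral_lsc PU rhoO (c := fun x => sqnorm (lsubmx x - rsubmx x))).
- move=> x; apply: continuous_comp; last exact: continuous_sqnorm.
  by apply: continuousB; [exact: continuous_lsubmx|exact: continuous_rsubmx].
- by move=> x; exact: sqnorm_ge0.
(* The costs along the sequence are eventually below [L + e], and [U] is finer than [\oo]. *)
move=> e e0; apply: Uoo.
have [n _ ne] := near_infty_natSinv_lt (PosNum e0).
exists n => // k /ne /= ke.
rewrite ge0_integral_pushforward//; last 2 first.
- apply/measurable_EFinP; apply: continuous_measurable_rV => x.
  apply: continuous_comp; last exact: continuous_sqnorm.
  by apply: continuousB; [exact: continuous_lsubmx|exact: continuous_rsubmx].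
- by move=> x _; rewrite lee_fin sqnorm_ge0.
rewrite preimage_setT; apply: (@le_trans _ _ (transport_cost (ga k))).
  rewrite le_eqVlt; apply/orP; left; apply/eqP; apply: eq_integral => z _ /=.
  by rewrite /join_pair row_mxKl row_mxKr.
by apply: le_trans (gaP k).2 _; rewrite lee_fin lerD2l ltW.
Qed.

End optimal_coupling.

(** * Gluing of couplings *)

(** Rational balls whose points are pairwise within [e] are enumerated by [unpickle], with the empty
    set for all other codes, and made disjoint by [seqDU]. They cover because a ball of radius
    [e / 2] is a union of rational balls contained in it. *)
Lemma small_cells (R : realType) N (e : R) : 0 < e ->
  exists Q : nat -> set 'rV[R]_N, [/\ forall i, measurable (Q i),
    trivIset setT Q, \bigcup_i Q i = setT &
    forall i x y, Q i x -> Q i y -> ball x e y].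
Proof.
move=> e0.
pose F i : set 'rV[R]_N :=
  if unpickle i is Some (q, n) then
    let B :=
      ball (map_mx ratr (q : 'rV[rat]_N) : 'rV[R]_N) (n : nat).+1%:R^-1 in
    if `[< forall x y, B x -> B y -> ball x e y >] then B else set0
  else set0.
have mF i : measurable (F i).
  rewrite /F; case: (unpickle i) => [[q n]|//]; case: ifP => // _.
  by apply: open_measurable_rV; exact: ball_open.
have Fe i x y : F i x -> F i y -> ball x e y.
  rewrite /F; case: (unpickle i) => [[q n]|//].
  by case: asboolP => // h; exact: h.
exists (seqDU F); split.
- exact: seqDU_measurable.
- exact: trivIset_seqDU.
- rewrite -seqDU_bigcup_eq; apply/seteqP; split => // x _.
  have e20 : 0 < e / 2 by rewrite divr_gt0.
  have : ball x (e / 2) x by exact: ballxx.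
  rewrite {1}(open_rV_bigcup (ball_open x (e / 2))) => -[[q n] _ [/= qx qxe]].
  exists (pickle (q, n)) => //; rewrite /F pickleK.
  case: asboolP => // -[] y z /qxe xy /qxe xz.
  by rewrite (splitr e); apply: ball_triangle xz; exact: ball_sym.
- by move=> i x y [Fx _] [Fy _]; exact: Fe Fx Fy.
Qed.

Lemma measurable_preimageT d1 d2 (T1 : measurableType d1)
    (T2 : measurableType d2) (f : T1 -> T2) A :
  measurable_fun setT f -> measurable A -> measurable (f @^-1` A).
Proof. by move=> mf mA; rewrite -[X in measurable X]setTI; exact: mf. Qed.

Section glue_along_cells.
Context (R : realType) d0 d1 d2 (X : measurableType d0)
  (T1 : measurableType d1) (T2 : measurableType d2).
Context (ga1 : {measure set T1 -> \bar R}) (ga2 : {measure set T2 -> \bar R})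
  (al : {measure set X -> \bar R}) (p : R)
  (f : T1 -> X) (g : T2 -> X)
  (mf : measurable_fun setT f) (mg : measurable_fun setT g).
Context (alT : al setT = p%:E) (ga1f : same_measure (pushforward ga1 f) al)
  (ga2g : same_measure (pushforward ga2 g) al).
Context (Q : nat -> set X) (mQ : forall i, measurable (Q i))
  (tQ : trivIset setT Q) (QT : \bigcup_i Q i = setT).
Local Open Scope ereal_scope.

Let al_fin A : measurable A -> al A \is a fin_num.
Proof.
move=> mA; rewrite ge0_fin_numE//; apply: le_lt_trans (ltry p).
by rewrite -alT le_measure ?inE.
Qed.

(** Dividing by the mass of the cell undoes the mass contributed by the other factor of the product.
    If that mass is 0, both sides vanish, since [ga] has marginal [al]. *)
Let cell_weight d (T : measurableType d) (ga : {measure set T -> \bar R})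
    (h : T -> X) A i : measurable_fun setT h ->
  same_measure (pushforward ga h) al -> measurable A ->
  ((fine (al (Q i)))^-1)%:E * (ga (A `&` h @^-1` Q i) * al (Q i)) =
  ga (A `&` h @^-1` Q i).
Proof.
move=> mh gah mA.
have mhQ : measurable (h @^-1` Q i) by exact: measurable_preimageT.
have [a0|a0] := eqVneq (al (Q i)) 0.
  rewrite a0 mule0 mule0; apply/esym/eqP; rewrite eq_le measure_ge0 andbT.
  by rewrite -a0 -gah// le_measure ?inE//; exact: measurableI.
rewrite muleCA -[X in _ * (_ * X)](fineK (al_fin (mQ i))) -EFinM mulVf ?mule1//.
by rewrite fine_eq0// al_fin.
Qed.

Let sum_cells d (T : measurableType d) (ga : {measure set T -> \bar R})
    (h : T -> X) A : measurable_fun setT h ->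
  measurable A -> \sum_(i <oo) ga (A `&` h @^-1` Q i) = ga A.
Proof.
move=> mh mA; rewrite -measure_semi_bigcup.
- by rewrite -setI_bigcupr -preimage_bigcup QT preimage_setT setIT.
- by move=> i; apply: measurableI => //; exact: measurable_preimageT.
- apply: trivIset_setIl; apply/trivIsetP => i j _ _ ij.
  move/trivIsetP : tQ => /(_ i j I I ij) Qij.
  by rewrite -preimage_setI Qij preimage_set0.
- apply: bigcup_measurable => i _; apply: measurableI => //.
  exact: measurable_preimageT.
Qed.

(** A discrete substitute for disintegration: the sum over the cells of the products of the
    restrictions, each divided by the mass of its cell. The first marginal is exact. The second is
    recorded as a bound that only inspects pairs over a common cell, since [M] charges no others. *)
Lemma glue_along_cells : exists M : {measure set (T1 * T2) -> \bar R},
  (forall A, measurable A -> M (A `*` setT) = ga1 A) /\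
  (forall S B, measurable S -> measurable B ->
    (forall i a b, Q i (f a) -> Q i (g b) -> S (a, b) -> B b) -> M S <= ga2 B).
Proof.
have ga2T : ga2 setT = p%:E by rewrite -alT -ga2g.
pose ga2' : {finite_measure set T2 -> \bar R} := finite_measure_of ga2T.
have mfQ i : measurable (f @^-1` Q i) by exact: measurable_preimageT.
have mgQ i : measurable (g @^-1` Q i) by exact: measurable_preimageT.
have c0 i : (0 <= (fine (al (Q i)))^-1)%R by rewrite invr_ge0 fine_ge0.
pose m1 i : {measure set T1 -> \bar R} := mrestr ga1 (mfQ i).
pose m2 i : {finite_measure set T2 -> \bar R} := mrestr ga2' (mgQ i).
pose m12 i : {measure set (T1 * T2) -> \bar R} := m1 i \x m2 i.
pose Mi i : {measure set (T1 * T2) -> \bar R} := mscale (NngNum (c0 i)) (m12 i).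
have MiE i S : Mi i S = ((fine (al (Q i)))^-1)%:E * m12 i S by [].
have prodE i A B : measurable A -> measurable B ->
    m12 i (A `*` B) = ga1 (A `&` f @^-1` Q i) * ga2 (B `&` g @^-1` Q i).
  move=> mA mB.
  exact: (@product_measure1E _ _ _ _ _ (m1 i) (m2 i) A B mA mB).
exists (mseries Mi 0); split.
- move=> A mA; rewrite /mseries -[RHS](@sum_cells _ _ ga1 f)//.
  apply: eq_eseriesr => i _; rewrite MiE prodE// setTI.
  by rewrite -[RHS](cell_weight i mf ga1f mA) -(ga2g (mQ i)).
- move=> S B mS mB SB; rewrite /mseries -(@sum_cells _ _ ga2 g B)//.
  apply: lee_nneseries => // i _; rewrite MiE -(cell_weight i mg ga2g mB).
  rewrite lee_wpmul2l// ?lee_fin//.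
  (* [S1] carries the bound, while [S2] and [S3] are null for [m12 i], which is concentrated on the
     pairs over cell [i]. *)
  pose S1 := setT `*` B : set (T1 * T2).
  pose S2 := (~` (f @^-1` Q i)) `*` setT : set (T1 * T2).
  pose S3 := setT `*` (~` (g @^-1` Q i)) : set (T1 * T2).
  have mS1 : measurable S1 by exact: measurableX.
  have mS2 : measurable S2 by apply: measurableX => //; exact: measurableC.
  have mS3 : measurable S3 by apply: measurableX => //; exact: measurableC.
  have S123 : S `<=` S1 `|` (S2 `|` S3).
    move=> [a b] Sab; have [fa|fa] := pselect (Q i (f a)); last by right; left.
    have [gb|gb] := pselect (Q i (g b)); last by right; right.
    by left; split=> //; exact: (SB i a b).
  apply: (@le_trans _ _ (m12 i S1 + (m12 i S2 + m12 i S3))).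
    have mS23 : measurable (S2 `|` S3) by exact: measurableU.
    apply: (@le_trans _ _ (m12 i (S1 `|` (S2 `|` S3)))).
      by rewrite le_measure ?inE//; exact: measurableU.
    apply: (le_trans (measureU2 (m12 i) mS1 mS23)).
    by rewrite leeD2l// (measureU2 (m12 i)).
  rewrite prodE// prodE//; last exact: measurableC.
  rewrite prodE//; last exact: measurableC.
  rewrite !setTI !setICl !measure0 mul0e mule0 !adde0 muleC.
  by rewrite lee_wpmul2l// -ga1f.
Qed.

End glue_along_cells.

Section gluing.
Context (R : realType) (d : nat).
Local Notation V := 'rV[R]_d.
Local Notation V2 := 'rV[R]_(d + d).
Local Notation V3 := 'rV[R]_(d + d + d).

(** The argument consists of a point [(x1, x2)] for the first coupling and a point [(x1', x3)] for
    the second. Only [x1] is kept; for the measures used below, [x1'] differs from it by less than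
    the cell size. *)
Definition join_glued (w : (V * V) * (V * V)) : V3 :=
  row_mx (row_mx w.1.1 w.1.2) w.2.2.

Definition split_triple (x : V3) : V * V * V :=
  (lsubmx (lsubmx x), rsubmx (lsubmx x), rsubmx x).

Definition drop_middle (x : V3) : V2 := row_mx (lsubmx (lsubmx x)) (rsubmx x).

Let measurable_join_glued : measurable_fun setT join_glued.
Proof.
apply: measurable_row_mx; first apply: measurable_row_mx.
- exact: (measurableT_comp measurable_fst measurable_fst).
- exact: (measurableT_comp measurable_snd measurable_fst).
- exact: (measurableT_comp measurable_snd measurable_snd).
Qed.

Let measurable_ll : measurable_fun setT (fun x : V3 => lsubmx (lsubmx x)).
Proof. by apply: measurableT_comp; exact: measurable_lsubmx. Qed.

Let measurable_split_triple : measurable_fun setT split_triple.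
Proof.
apply: measurable_fun_pair; last exact: measurable_rsubmx.
apply: measurable_fun_pair => //.
by apply: measurableT_comp; [exact: measurable_rsubmx|
  exact: measurable_lsubmx].
Qed.

Let measurable_drop_middle : measurable_fun setT drop_middle.
Proof. by apply: measurable_row_mx => //; exact: measurable_rsubmx. Qed.

HB.instance Definition _ :=
  isMeasurableFun.Build _ _ _ _ join_glued measurable_join_glued.
HB.instance Definition _ :=
  isMeasurableFun.Build _ _ _ _ split_triple measurable_split_triple.
HB.instance Definition _ :=
  isMeasurableFun.Build _ _ _ _ drop_middle measurable_drop_middle.

Let continuous_drop_middle : continuous drop_middle.
Proof.
move=> x A /nbhs_ballP[e /= e0 eA]; apply/nbhs_ballP; exists e => //= y [_ xy].
apply: eA; apply: ball_row_mx; split=> // i j; rewrite !mxE; exact: xy.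
Qed.

Context (al be1 be2 : {measure set V -> \bar R}) (p : R) (alT : al setT = p%:E)
  (be1T : be1 setT = p%:E) (be2T : be2 setT = p%:E)
  (ga1 ga2 : {measure set (V * V) -> \bar R})
  (ga1c : couplings al be1 ga1) (ga2c : couplings al be2 ga2).
Local Open Scope ereal_scope.

(** Each [mu k] reproduces [ga1] exactly, and [ga2] up to moving one coordinate by less than
    [k.+1%:R^-1]. The limit removes this error. *)
Lemma gluing : exists bmu : {measure set (V * V * V) -> \bar R},
  same_measure (image_measure bmu (@pi12 R d)) ga1 /\
  same_measure (image_measure bmu (@pi13 R d)) ga2.
Proof.
have glued k : exists M : {measure set ((V * V) * (V * V)) -> \bar R},
    (forall A, measurable A -> M (A `*` setT) = ga1 A) /\
    (forall S B, measurable S -> measurable B ->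
      (forall a b : V * V, ball a.1 k.+1%:R^-1 b.1 -> S (a, b) -> B b) ->
      M S <= ga2 B).
  have k0 : (0 < k.+1%:R^-1 :> R)%R by rewrite invr_gt0.
  have [Q [mQ tQ QT Qe]] := small_cells d k0.
  have [||M [M1 M2]] := @glue_along_cells _ _ _ _ _ _ _ ga1 ga2 al p
    fst fst measurable_fst measurable_fst alT _ _ _ mQ tQ QT.
  - exact: ga1c.1.
  - exact: ga2c.1.
  exists M; split=> // S B mS mB SB; apply: M2 => // i a b Qa Qb.
  by apply: SB; exact: Qe Qa Qb.
have /choice[M MP] := glued.
pose mu k : {measure set V3 -> \bar R} := image_measure (M k) join_glued.
have muE k A : mu k A = M k (join_glued @^-1` A) by [].
have mu_l k A : measurable A ->
    mu k (lsubmx @^-1` A) = ga1 (@join_pair R d d @^-1` A).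
  move=> mA; rewrite muE -(MP k).1; last exact: measurable_funPTI.
  congr (M k _); apply/seteqP; split=> -[a b] /=.
    by rewrite /join_glued row_mxKl.
  by rewrite /join_glued row_mxKl => -[].
have muT k : mu k setT = p%:E.
  rewrite -(preimage_setT (@lsubmx R 1 (d + d) d)) mu_l// preimage_setT.
  by rewrite -(coupling_mass alT ga1c).
have mu_tight e : (0 < e)%R -> exists r, forall k,
    mu k [set x | (r < `|x|)%R] <= e%:E.
  move=> e0; have e20 : (0 < e / 2)%R by rewrite divr_gt0.
  have [r1 ga1r] := @coupling_join_tight _ _ al be1 p alT be1T
    (fun=> ga1) _ (fun=> ga1c) e20.
  have [r2 be2r] := measure_tight be2T e20.
  exists (Num.max r1 r2) => k; set r := Num.max r1 r2.
  have mr N : measurable [set x : 'rV[R]_N | (r < `|x|)%R].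
    exact: (open_measurable_rV (@open_norm_gt _ _ _)).
  pose S1 := (@join_pair R d d @^-1` [set x | (r < `|x|)%R]) `*` [set: V * V].
  pose S2 := [set: V * V] `*` (@snd V V @^-1` [set x | (r < `|x|)%R]).
  have mS1 : measurable S1.
    by apply: measurableX => //; apply: measurable_funPTI; exact: mr.
  have msnd : measurable (@snd V V @^-1` [set x | (r < `|x|)%R]).
    by apply: measurable_preimageT; [exact: measurable_snd|exact: mr].
  have mS2 : measurable S2 by exact: measurableX.
  apply: (@le_trans _ _ (M k (S1 `|` S2))).
    rewrite muE le_measure ?inE//.
    - apply: measurable_funPTI; exact: mr.
    - exact: measurableU.
    - move=> [a b]; rewrite /join_glued/= => ab; apply: contrapT.
      move=> /not_orP[S1ab S2ab].
      have xr : (`|join_pair a| <= r)%R.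
        by rewrite leNgt; apply/negP => h; apply: S1ab.
      have yr : (`|b.2| <= r)%R.
        by rewrite leNgt; apply/negP => h; apply: S2ab.
      by have := norm_row_mx_le xr yr; rewrite leNgt ab.
  apply: (le_trans (measureU2 (M k) mS1 mS2)).
  rewrite (splitr e) EFinD leeD//.
  - have S1E : M k S1 <= ga1 (@join_pair R d d @^-1` [set x | (r < `|x|)%R]).
      by rewrite (MP k).1//; apply: measurable_funPTI; exact: mr.
    apply: (le_trans S1E); apply: le_trans (ga1r k); rewrite le_measure ?inE//.
    + apply: measurable_funPTI; exact: mr.
    + apply: measurable_funPTI.
      exact: (open_measurable_rV (@open_norm_gt _ _ _)).
    + by move=> x /=; apply: le_lt_trans; rewrite le_max lexx.
  - apply: (@le_trans _ _ (ga2 (@snd V V @^-1` [set x | (r < `|x|)%R]))).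
      by apply: (MP k).2 => // a b _ [].
    have := ga2c.2 _ (mr d); rewrite /pushforward => ->.
    by rewrite be2r// le_max lexx orbT.
have [U [rho [PU Uoo rhoT rhoO]]] := tight_limit muT mu_tight.
have rhoO' := near_le_of_erosion PU rhoO.
exists (image_measure rho split_triple); split=> A mA.
- pose ga1' : {measure set V2 -> \bar R} :=
    image_measure ga1 (@join_pair R d d).
  have ga1'T : ga1' setT = p%:E by rewrite -(coupling_mass alT ga1c).
  have mB : measurable (@split_pair R d d @^-1` A) by exact: measurable_funPTI.
  have := same_measure_limit (f := @lsubmx R 1 (d + d) d) PU
    (@continuous_lsubmx _ _ _) rhoO' rhoT ga1'T mu_l mB.
  rewrite [X in _ = X](_ : _ = ga1 A)//.
  rewrite /ga1' /image_measure /pushforward; congr (ga1 _).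
  by apply/seteqP; split=> z; rewrite /= join_pairK.
- pose ga2' : {measure set V2 -> \bar R} :=
    image_measure ga2 (@join_pair R d d).
  have ga2'T : ga2' setT = p%:E by rewrite -(coupling_mass alT ga2c).
  have mB : measurable (@split_pair R d d @^-1` A) by exact: measurable_funPTI.
  have rho2 : same_measure (image_measure rho drop_middle) ga2'.
    apply: (@same_measure_open _ _
      (image_measure rho drop_middle) ga2' p) => //.
    move=> B oB; apply/lee_addgt0Pr => e e0.
    have oC : open (drop_middle @^-1` B).
      by apply: open_comp => // x _; exact: continuous_drop_middle.
    (* Here the erosion is essential. Once [k.+1%:R^-1] is below [r], replacing [x] by [x'] keeps a
       point of the erosion inside the preimage of [B]; [drop_middle] then gives [(x', z)], a point
       governed by [ga2]. *)
    have [r r0 rhor] := rhoO _ _ oC e0.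
    have Ur : \forall k \near U, (k.+1%:R^-1 < r)%R.
      by apply: Uoo; exact: (near_infty_natSinv_lt (PosNum r0)).
    have [k [rhok kr]] := filter_ex (filterI rhor Ur).
    apply: le_trans rhok _; rewrite leeD2r// muE; apply: (MP k).2.
    + apply: measurable_funPTI.
      exact: (closed_measurable_rV (@closed_erosion _ _ _ _)).
    + apply: measurable_funPTI; exact: open_measurable_rV.
    move=> [x y] [x' z] /= xx' /(_ (row_mx (row_mx x' y) z)).
    rewrite /drop_middle/= !row_mxKl row_mxKr; apply.
    apply: ball_row_mx; last exact: ballxx.
    apply: ball_row_mx; last exact: ballxx.
    by apply: le_ball xx'; exact: ltW.
  have := rho2 _ mB; rewrite [X in _ = X](_ : _ = ga2 A).
    move=> <-; rewrite /image_measure /pushforward; congr (rho _).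
    by apply/seteqP; split=> x; rewrite /= /split_pair row_mxKl row_mxKr.
  rewrite /ga2' /image_measure /pushforward; congr (ga2 _).
  by apply/seteqP; split=> z; rewrite /= join_pairK.
Qed.

End gluing.

(** * Three-fold plans whose projections are optimal *)

Section generalized_plan.
Context (R : realType) (d : nat).
Local Notation V := 'rV[R]_d.

Lemma integral_same_measure d1 (T : measurableType d1)
    (mu nu : {measure set T -> \bar R}) (f : T -> \bar R) :
  same_measure mu nu -> (\int[mu]_x f x = \int[nu]_x f x)%E.
Proof. by move=> munu; apply: eq_measure_integral => A mA _; exact: munu. Qed.

(** Marginals and costs depend only on values on measurable sets. This moves optimality to the
    projections of a glued plan, which agree with the given couplings only in the sense of
    [same_measure]. *)
Lemma optimal_coupling_same (al be : {measure set V -> \bar R})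
    (ga ga' : {measure set (V * V) -> \bar R}) :
  same_measure ga' ga ->
  optimal_coupling al be ga -> optimal_coupling al be ga'.
Proof.
move=> gaE [[ga_al ga_be] ga_opt]; split; first split.
- move=> A mA; rewrite -ga_al// /pushforward gaE//.
  by apply: measurable_preimageT => //; exact: measurable_fst.
- move=> A mA; rewrite -ga_be// /pushforward gaE//.
  by apply: measurable_preimageT => //; exact: measurable_snd.
- by move=> ga0 /ga_opt; rewrite /transport_cost (integral_same_measure _ gaE).
Qed.

Lemma generalized_plan_exists (al be1 be2 : {measure set V -> \bar R}) (p : R) :
  0 < p -> al setT = p%:E -> be1 setT = p%:E -> be2 setT = p%:E ->
  exists bmu : {measure set (V * V * V) -> \bar R},
  [/\ same_measure (image_measure bmu (@pi1 R d)) al,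
      same_measure (image_measure bmu (@pi2 R d)) be1,
      same_measure (image_measure bmu (@pi3 R d)) be2,
      optimal_coupling al be1 (image_measure bmu (@pi12 R d)) &
      optimal_coupling al be2 (image_measure bmu (@pi13 R d))].
Proof.
move=> p0 alT be1T be2T.
have [ga1 ga1o] := optimal_coupling_exists p0 alT be1T.
have [ga2 ga2o] := optimal_coupling_exists p0 alT be2T.
have [bmu [bmu1 bmu2]] := gluing alT be1T be2T ga1o.1 ga2o.1.
have mfst A : measurable A -> measurable (@fst V V @^-1` A).
  by move=> mA; apply: measurable_preimageT => //; exact: measurable_fst.
have msnd A : measurable A -> measurable (@snd V V @^-1` A).
  by move=> mA; apply: measurable_preimageT => //; exact: measurable_snd.
exists bmu; split.
- by move=> A mA; exact: (etrans (bmu1 _ (mfst A mA)) (ga1o.1.1 A mA)).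
- by move=> A mA; exact: (etrans (bmu1 _ (msnd A mA)) (ga1o.1.2 A mA)).
- by move=> A mA; exact: (etrans (bmu2 _ (msnd A mA)) (ga2o.1.2 A mA)).
- exact: optimal_coupling_same bmu1 ga1o.
- exact: optimal_coupling_same bmu2 ga2o.
Qed.

End generalized_plan.

(** * Convexity of the interaction energy *)

(** Positive and negative parts are transported separately, so the integrand may have either
    sign. *)
Lemma integral_image_measure d1 d2 (T1 : measurableType d1)
    (T2 : measurableType d2) (R : realType) (mu : {measure set T1 -> \bar R})
    (nu : {measure set T2 -> \bar R}) (f : {mfun T1 >-> T2})
    (g : T2 -> \bar R) :
  same_measure (image_measure mu f) nu -> measurable_fun setT g ->
  (\int[nu]_y g y = \int[mu]_x g (f x))%E.
Proof.
move=> munu mg.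
have -> : (\int[nu]_y g y = \int[image_measure mu f]_y g y)%E.
  by apply: eq_measure_integral => A mA _; rewrite -munu.
rewrite [LHS]integralE [RHS]integralE; congr (_ - _)%E.
- rewrite ge0_integral_pushforward//.
    by apply: eq_integral => x _; rewrite /= !funeposE.
  exact: measurable_funepos.
- rewrite ge0_integral_pushforward//.
    by apply: eq_integral => x _; rewrite /= !funenegE.
  exact: measurable_funeneg.
Qed.

Lemma measurable_integral1 d1 d2 (T1 : measurableType d1)
    (T2 : measurableType d2) (R : realType)
    (mu : {sigma_finite_measure set T1 -> \bar R}) (F : T1 * T2 -> \bar R) :
  measurable_fun setT F -> measurable_fun setT (fun y => \int[mu]_x F (x, y))%E.
Proof.
move=> mF.
rewrite (_ : (fun y => _) =
    (fun y => fubini_G mu F^\+ y - fubini_G mu F^\- y)%E).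
  apply: emeasurable_funB; apply: measurable_fun_fubini_tonelli_G => //.
  - exact: measurable_funepos.
  - exact: measurable_funeneg.
apply/funext => y; rewrite [LHS]integralE; congr (_ - _)%E;
  by apply: eq_integral => x _; rewrite /= ?funeposE ?funenegE.
Qed.

(** * Integrability and Fubini's theorem on products of finite measures *)

Section product_integrals.
Context (R : realType) d (T : measurableType d).
Context (mu1 mu2 : {finite_measure set T -> \bar R}).
Context (q : T -> R)
  (q1 : mu1.-integrable setT (EFin \o q))
  (q2 : mu2.-integrable setT (EFin \o q)).
Local Notation M := (mu1 \x mu2)%E.


Let measurable_comp_fst (u : T -> R) : measurable_fun setT u ->
  measurable_fun [set: T * T] (u \o fst).
Proof. by move=> mu; exact: (measurableT_comp mu measurable_fst). Qed.

Let measurable_comp_snd (u : T -> R) : measurable_fun setT u ->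
  measurable_fun [set: T * T] (u \o snd).
Proof. by move=> mu; exact: (measurableT_comp mu measurable_snd). Qed.

Let le_lt_fin (m : {finite_measure set T -> \bar R}) (x : \bar R) :
  (0 <= x -> x < +oo -> x * m setT < +oo)%E.
Proof.
move=> x0 xy; rewrite -ge0_fin_numE ?mule_ge0// fin_numM//.
  by rewrite ge0_fin_numE.
exact: fin_num_measure.
Qed.

Lemma integrable_fst (u : T -> R) : mu1.-integrable setT (EFin \o u) ->
  M.-integrable setT (EFin \o (u \o fst)).
Proof.
move=> /integrableP[/measurable_EFinP mu ui]; apply/integrableP; split.
  by apply/measurable_EFinP; exact: measurable_comp_fst.
rewrite fubini_tonelli1//; last first.
  apply: measurableT_comp => //; apply/measurable_EFinP.
  exact: measurable_comp_fst.
rewrite /fubini_F/=; under eq_integral do rewrite integral_cst//.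
rewrite ge0_integralZr//; last by apply/measurable_EFinP/measurableT_comp.
by apply: le_lt_fin => //; exact: integral_ge0.
Qed.

Lemma integrable_snd (u : T -> R) : mu2.-integrable setT (EFin \o u) ->
  M.-integrable setT (EFin \o (u \o snd)).
Proof.
move=> /integrableP[/measurable_EFinP mu ui]; apply/integrableP; split.
  by apply/measurable_EFinP; exact: measurable_comp_snd.
rewrite fubini_tonelli2//; last first.
  apply: measurableT_comp => //; apply/measurable_EFinP.
  exact: measurable_comp_snd.
rewrite /fubini_G/=; under eq_integral do rewrite integral_cst//.
rewrite ge0_integralZr//; last by apply/measurable_EFinP/measurableT_comp.
by apply: le_lt_fin => //; exact: integral_ge0.
Qed.

Lemma integrable_growth (F : T * T -> R) (C : R) : measurable_fun setT F ->
  (forall z, `|F z| <= C * (1 + q z.1 + q z.2)) ->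
  M.-integrable setT (EFin \o F).
Proof.
move=> mF FC.
apply: (@le_integrable _ _ _ M setT measurableT _
    (EFin \o (fun z : T * T => C * (1 + q z.1 + q z.2)))).
- exact/measurable_EFinP.
- by move=> z _ /=; rewrite lee_fin (le_trans (FC z))// ler_norm.
- pose u0 (z : T * T) := (EFin \o ((fun=> 1 : R) \o @fst T T)) z.
  pose u1 (z : T * T) := (EFin \o (q \o @fst T T)) z.
  pose u2 (z : T * T) := (EFin \o (q \o @snd T T)) z.
  rewrite (_ : EFin \o _ = fun z => (C%:E * (u0 \+ u1 \+ u2) z)%E); last first.
    by apply/funext => z /=; rewrite EFinM !EFinD.
  apply: integrableZl => //.
  apply: integrableD => //; last exact: integrable_snd.
  apply: integrableD => //; last exact: integrable_fst.
  by apply: integrable_fst; exact: finite_measure_integrable_cst.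
Qed.

Lemma integral_prodM (u v : T -> R) :
  mu1.-integrable setT (EFin \o u) -> mu2.-integrable setT (EFin \o v) ->
  M.-integrable setT (EFin \o (fun z => u z.1 * v z.2)) ->
  (\int[M]_z (u z.1 * v z.2)%:E =
   \int[mu1]_x (u x)%:E * \int[mu2]_y (v y)%:E)%E.
Proof.
move=> ui vi uvi; rewrite -integral12_prod_meas1//= /fubini_F/=.
under eq_integral do (under eq_integral do rewrite EFinM; rewrite integralZl//).
rewrite -(fineK (integrable_fin_num measurableT vi)).
by rewrite integralZr.
Qed.

End product_integrals.

(** * The quadratic form that produces [lambda0] *)

(** In the application [a i], [b i] and [D i j] are the integral of |xi|^2, the integral of xi and
    the double integral of |xi(X) - xi(Y)|^2; what remains is algebra in these numbers. *)
Lemma quadratic_lower_bound (R : realType) (d n : nat) (m p : 'I_n -> R)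
    (kappa : 'M[R]_n) (a : 'I_n -> R) (b : 'I_n -> 'I_d -> R)
    (D : 'I_n -> 'I_n -> R) (lambda : R) :
  (forall i, 0 < m i) -> (forall i, 0 < p i) -> kappa^T = kappa ->
  (forall i, 0 <= a i) -> (forall i j, 0 <= D i j) ->
  (forall i j,
    D i j = p j * a i + p i * a j - 2 * \sum_(k < d) b i k * b j k) ->
  (forall k, \sum_j (m j)^-1 * b j k = 0) ->
  lambda <= lambda0 m p kappa ->
  lambda * \sum_j (m j)^-1 * a j <= 2^-1 * \sum_i \sum_j kappa i j * D i j.
Proof.
move=> m0 p0 ksym a0 D0 DE b0 lam.
pose et := eta m kappa.
(* For [i != j] both summands in the mean are lower bounds of [kappa i j]: one by the definition of
   [et i], the other by that of [et j] and the symmetry of [kappa]. *)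
pose c i j := 2^-1 * (et i / m j + et j / m i).
pose mn i := Num.min 0 (m i * kappa i i - et i).
have DC i j : D i j = D j i.
  rewrite !DE [p j * _ + _]addrC; congr (_ - _ * _).
  by apply: eq_bigr => k _; rewrite mulrC.
have kc i j : i != j -> c i j <= kappa i j.
  move=> ij.
  have k1 : et i / m j <= kappa i j.
    by rewrite ler_pdivrMr//; apply: fmin_le; rewrite eq_sym.
  have k2 : et j / m i <= kappa i j.
    rewrite ler_pdivrMr// -ksym mxE; exact: fmin_le.
  by rewrite /c; lra.
(* The discarded term is twice the squared norm of [b i]. *)
have Dii i : D i i <= 2 * (p i * a i).
  have : 0 <= \sum_(k < d) b i k * b i k.
    by apply: sumr_ge0 => k _; rewrite -expr2 sqr_ge0.
  by rewrite DE; lra.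
(* On the diagonal [kappa i i] may be smaller than [c i i]. The deficit is at most [- mn i / m i],
   and as [mn i] is nonpositive, the upper bound [Dii] controls its contribution. *)
have step1 i j :
    c i j * D i j + (i == j)%:R * (2 * (p i * a i) * (mn i / m i)) <=
    kappa i j * D i j.
  have [<-{j}|ij] := eqVneq i j; last by rewrite mul0r addr0 ler_wpM2r// kc.
  rewrite mul1r.
  have -> : c i i = et i / m i by rewrite /c; lra.
  have mnle : mn i / m i <= kappa i i - et i / m i.
    rewrite ler_pdivrMr//.
    have -> : (kappa i i - et i / m i) * m i = m i * kappa i i - et i.
      by field; rewrite gt_eqF.
    by rewrite ge_min lexx orbT.
  have mn0 : mn i / m i <= 0.
    by rewrite ler_pdivrMr// mul0r ge_min lexx.
  have h1 := ler_wpM2r (D0 i i) mnle.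
  have h2 := ler_wnM2l mn0 (Dii i).
  by lra.
(* The symmetrization in [c] disappears after summation because [D] is symmetric. *)
have sumc : \sum_i \sum_j c i j * D i j = \sum_i \sum_j et i / m j * D i j.
  transitivity (2^-1 * (\sum_i \sum_j et i / m j * D i j +
                        \sum_i \sum_j et j / m i * D i j)).
    rewrite -big_split mulr_sumr; apply: eq_bigr => i _ /=.
    rewrite -big_split mulr_sumr; apply: eq_bigr => j _ /=.
    by rewrite /c; ring.
  rewrite [X in _ + X]exchange_big/=.
  under [X in _ + X]eq_bigr do under eq_bigr do rewrite DC.
  by lra.
have sumD : \sum_i \sum_j et i / m j * D i j =
    \sum_i (m i)^-1 * a i * \sum_j p j * (et j + et i * (m i / m j)).
  (* The last sum contains the factors [\sum_j (m j)^-1 * b j k], which vanish by [b0]. *)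
  transitivity (\sum_i \sum_j et i / m j * (p j * a i) +
    \sum_i \sum_j et i / m j * (p i * a j) -
    2 * \sum_i \sum_(k < d) et i * b i k * \sum_j (m j)^-1 * b j k).
    rewrite mulr_sumr -big_split -sumrB; apply: eq_bigr => i _ /=.
    under [X in _ - 2 * X]eq_bigr do rewrite mulr_sumr.
    rewrite exchange_big/= mulr_sumr -big_split -sumrB.
    apply: eq_bigr => j _ /=.
    rewrite DE mulrBr mulrDr; congr (_ - _).
    rewrite mulrCA; congr (_ * _); rewrite mulr_sumr; apply: eq_bigr => k _.
    by ring.
  under [X in _ - 2 * X]eq_bigr do under eq_bigr do rewrite b0 mulr0.
  rewrite [X in _ - 2 * X]big1 ?mulr0 ?subr0; last by move=> i _; rewrite big1.
  rewrite [X in _ + X]exchange_big/= -big_split; apply: eq_bigr => i _ /=.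
  rewrite -big_split mulr_sumr; apply: eq_bigr => j _ /=.
  by field; rewrite !gt_eqF.
apply: (@le_trans _ _ (2^-1 * \sum_i \sum_j
  (c i j * D i j +
   (i == j)%:R * (2 * (p i * a i) * (mn i / m i))))); last first.
  rewrite ler_wpM2l ?invr_ge0//.
  by apply: ler_sum => i _; apply: ler_sum => j _; exact: step1.
under [X in _ <= _ * X]eq_bigr do rewrite big_split/=.
rewrite [X in _ <= _ * X]big_split/= sumc sumD.
have -> : \sum_i \sum_j (i == j)%:R * (2 * (p i * a i) * (mn i / m i)) =
    \sum_i 2 * (p i * a i) * (mn i / m i).
  apply: eq_bigr => i _; rewrite (bigD1 i)//= eqxx mul1r big1 ?addr0// => j ji.
  by rewrite eq_sym (negbTE ji) mul0r.
rewrite -big_split !mulr_sumr; apply: ler_sum => i _ /=.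
have : lambda <=
    p i * mn i + 2^-1 * \sum_(j < n) p j * (et j + et i * (m i / m j)).
  apply: le_trans lam _; exact: (fmin_le (P := xpredT)).
have ma : 0 <= (m i)^-1 * a i by rewrite mulr_ge0// invr_ge0 ltW.
move=> /(ler_wpM2r ma).
set S := \sum_j _; move=> h; apply: le_trans h _.
rewrite le_eqVlt; apply/orP; left.
by apply/eqP; field; rewrite gt_eqF.
Qed.

Lemma Rintegral_sum d (T : measurableType d) (R : realType)
    (mu : {measure set T -> \bar R}) (I : Type) (s : seq I) (F : I -> T -> R) :
  (forall i, mu.-integrable setT (EFin \o F i)) ->
  \int[mu]_x (\sum_(i <- s) F i x) = \sum_(i <- s) \int[mu]_x F i x.
Proof.
move=> Fi; elim: s => [|i s ih].
  rewrite big_nil (_ : (fun x => _) = cst 0); last first.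
    by apply/funext => x; rewrite big_nil.
  by rewrite /Rintegral integral0.
rewrite big_cons -ih -RintegralD//.
  by congr fine; apply: eq_integral => x _; rewrite big_cons.
rewrite (_ : _ \o _ = fun x => (\sum_(i <- s) (EFin \o F i) x)%E).
  exact: integrable_sum.
by apply/funext => x /=; rewrite sumEFin.
Qed.

Section sqnorm_identities.
Context (R : realType) (d : nat).
Implicit Types x y : 'rV[R]_d.

(** Turns convexity of [W] minus a quadratic term into a bound with the remainder [s * (1 - s)]. *)
Lemma sqnorm_interp (s : R) x y : sqnorm ((1 - s) *: x + s *: y) =
  (1 - s) * sqnorm x + s * sqnorm y - s * (1 - s) * sqnorm (y - x).
Proof.
rewrite /sqnorm !mulr_sumr -big_split -sumrB; apply: eq_bigr => k _ /=.
by rewrite !mxE; ring.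
Qed.

Lemma sqnormB_le x y : sqnorm (x - y) <= 2 * (sqnorm x + sqnorm y).
Proof.
rewrite /sqnorm -big_split mulr_sumr; apply: ler_sum => k _ /=; rewrite !mxE.
have := sqr_ge0 (x 0 k + y 0 k); nra.
Qed.

Lemma sqnormB x y :
  sqnorm (x - y) = sqnorm x + sqnorm y - 2 * \sum_k x 0 k * y 0 k.
Proof.
rewrite /sqnorm mulr_sumr -big_split -sumrB; apply: eq_bigr => k _ /=.
by rewrite !mxE; ring.
Qed.

Lemma coord_sqr_le x k : x 0 k ^+ 2 <= sqnorm x.
Proof.
by rewrite /sqnorm (bigD1 k)//= lerDl sumr_ge0// => l _; exact: sqr_ge0.
Qed.

Lemma measurable_rVB d' (T : measurableType d') (f g : T -> 'rV[R]_d) :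
  measurable_fun setT f -> measurable_fun setT g ->
  measurable_fun setT (fun t => f t - g t).
Proof.
move=> /measurable_fun_rVP mf /measurable_fun_rVP mg.
apply/measurable_fun_rVP => k.
by under eq_fun do rewrite !mxE; exact: measurable_funB.
Qed.

End sqnorm_identities.

(** * Integrating the convexity inequality of [W] along the plans *)

Section energy_convexity.
Context (R : realType) (d n : nat).
Local Notation V := 'rV[R]_d.
Local Notation T := (V * V * V)%type.
Context (W : V -> 'M[R]_n) (kappa : 'M[R]_n) (W_adm : admissible W kappa).
Context (p : 'I_n -> R) (bmu : 'I_n -> {measure set T -> \bar R})
  (bmuT : forall i, bmu i setT = (p i)%:E).

Let mu i : {finite_measure set T -> \bar R} := finite_measure_of (bmuT i).

(** Dominates the squared norms of [pi2], [pi3] and [interp s] for [s] in [0,1], so one integrable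
    function controls all integrands below. *)
Let q (x : T) : R := sqnorm (pi2 x) + sqnorm (pi3 x).

Context (sq2 : forall i, (\int[bmu i]_x (sqnorm (pi2 x))%:E < +oo)%E)
  (sq3 : forall i, (\int[bmu i]_x (sqnorm (pi3 x))%:E < +oo)%E).

Let msq (f : {mfun T >-> V}) : measurable_fun setT (fun x => sqnorm (f x)).
Proof.
exact: (measurableT_comp (@measurable_sqnorm R d) (measurable_funPT f)).
Qed.

Let mq : measurable_fun setT q.
Proof. by apply: measurable_funD; exact: msq. Qed.

Let q0 x : 0 <= q x. Proof. by rewrite addr_ge0// sqnorm_ge0. Qed.

Let qi i : (mu i).-integrable setT (EFin \o q).
Proof.
have sqi (f : {mfun T >-> V}) : (\int[bmu i]_x (sqnorm (f x))%:E < +oo)%E ->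
    (mu i).-integrable setT (EFin \o (fun x => sqnorm (f x))).
  move=> fy; apply/integrableP; split.
    by apply/measurable_EFinP; exact: msq.
  by under eq_integral do rewrite /= ger0_norm ?sqnorm_ge0//.
rewrite (_ : EFin \o q = (EFin \o (fun x => sqnorm (pi2 x))) \+
  (EFin \o (fun x => sqnorm (pi3 x))))%E//.
by apply: integrableD => //; [exact: (sqi (@pi2 R d))|exact: (sqi (@pi3 R d))].
Qed.

Let integrable_growth1 i (F : T -> R) (C : R) : measurable_fun setT F ->
  (forall x, `|F x| <= C * (1 + q x)) -> (mu i).-integrable setT (EFin \o F).
Proof.
move=> mF FC.
apply: (@le_integrable _ _ _ (mu i) setT measurableT _
    (EFin \o (fun x => C * (1 + q x)))).
- exact/measurable_EFinP.
- by move=> z _ /=; rewrite lee_fin (le_trans (FC z))// ler_norm.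
- rewrite (_ : EFin \o _ = fun x => (C%:E * ((cst 1%:E) \+ (EFin \o q)) x)%E).
    apply: integrableZl => //; apply: integrableD => //.
      exact: finite_measure_integrable_cst.
    exact: qi.
  by apply/funext => x /=; rewrite EFinM EFinD.
Qed.

Local Notation M i j := (mu i \x mu j)%E.

Let mW i j : measurable_fun setT (fun z => W z i j).
Proof.
apply: continuous_measurable_rV => z; apply: differentiable_continuous.
exact: (admissible_C1 W_adm i j).1.
Qed.

Let W_growth :
  exists2 C, 0 <= C & forall z i j, `|W z i j| <= C * (1 + sqnorm z).
Proof.
have [Wbar WbarP] := admissible_growth W_adm.
exists (\sum_i \sum_j `|Wbar i j|).
  by apply: sumr_ge0 => i _; exact: sumr_ge0.
move=> z i j; apply: le_trans (WbarP z i j) _; rewrite ler_wpM2r//.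
  by rewrite addr_ge0// sqnorm_ge0.
rewrite (bigD1 i)//= (bigD1 j)//= -addrA (le_trans (ler_norm _))// lerDl.
by rewrite addr_ge0// sumr_ge0// => k _; exact: sumr_ge0.
Qed.

Let Wint (f : {mfun T >-> V}) i j : (forall x, sqnorm (f x) <= q x) ->
  (M i j).-integrable setT (EFin \o (fun z => W (f z.1 - f z.2) i j)).
Proof.
move=> fq; have [C C0 WC] := W_growth.
apply: (integrable_growth (qi i) (qi j) (C := C * 2)).
  apply: (measurableT_comp (mW i j)).
  by apply: measurable_rVB; apply: (measurableT_comp (measurable_funPT f)).
move=> [x y] /=; apply: le_trans (WC _ _ _) _; rewrite -mulrA ler_wpM2l//.
have := sqnormB_le (f x) (f y); have := fq x; have := fq y; lra.
Qed.

(** Both integrals are pulled back to triples and merged by Fubini's theorem. With [pi2], [pi3] and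
    [interp s] for [f], the three energies become integrals over the same product measures and can
    be compared pointwise. *)
Let energyE (f : {mfun T >-> V}) (nu : 'I_n -> {measure set V -> \bar R}) :
  (forall x, sqnorm (f x) <= q x) ->
  (forall i, same_measure (image_measure (bmu i) f) (nu i)) ->
  interaction_energy W nu =
  (2^-1 * \sum_i \sum_j \int[M i j]_z W (f z.1 - f z.2) i j)%:E.
Proof.
move=> fq bmunu; rewrite /interaction_energy EFinM; congr (_ * _)%E.
rewrite -sumEFin; apply: eq_bigr => i _.
rewrite -sumEFin; apply: eq_bigr => j _.
rewrite /Rintegral fineK; last first.
  exact: (integrable_fin_num measurableT (Wint i j fq)).
rewrite -(integral21_prod_meas1 (Wint i j fq)) /fubini_G/=.
transitivity (\int[nu j]_y \int[mu i]_x (W (f x - y) i j)%:E)%E.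
  apply: eq_integral => y _.
  rewrite (integral_image_measure (bmunu i))//.
  apply/measurable_EFinP; apply: (measurableT_comp (mW i j)).
  by apply: measurable_rVB => //.
rewrite (integral_image_measure (bmunu j))//.
apply: (@measurable_integral1 _ _ T V R (mu i)
  (fun z => (W (f z.1 - z.2) i j)%:E)).
apply/measurable_EFinP; apply: (measurableT_comp (mW i j)).
apply: measurable_rVB; last exact: measurable_snd.
exact: (measurableT_comp (measurable_funPT f) measurable_fst).
Qed.


Let xi (x : T) : V := pi3 x - pi2 x.

Let mxi : measurable_fun setT xi.
Proof. by apply: measurable_rVB. Qed.

Let mxik k : measurable_fun setT (fun x => xi x 0 k : R).
Proof. exact: (measurableT_comp (measurable_coord k) mxi). Qed.

Let msqxi : measurable_fun setT (fun x => sqnorm (xi x)).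
Proof. exact: (measurableT_comp (@measurable_sqnorm R d) mxi). Qed.

Let sqxi_le x : sqnorm (xi x) <= 2 * q x.
Proof. by rewrite /q addrC; exact: sqnormB_le. Qed.

Let sqxi_int i : (mu i).-integrable setT (EFin \o (fun x => sqnorm (xi x))).
Proof.
apply: (@integrable_growth1 i _ 2) => // x.
by rewrite ger0_norm ?sqnorm_ge0//; have := sqxi_le x; lra.
Qed.

Let xik_int i k : (mu i).-integrable setT (EFin \o (fun x => xi x 0 k : R)).
Proof.
apply: (@integrable_growth1 i _ 2) => // x.
have := sqxi_le x; have := coord_sqr_le (xi x) k.
by rewrite ler_norml => ? ?; apply/andP; split; nra.
Qed.

Let one_int i : (mu i).-integrable setT (EFin \o (fun=> 1 : R)).
Proof. exact: finite_measure_integrable_cst. Qed.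

Let Rintegral_prodM i j (u v : T -> R) :
  (mu i).-integrable setT (EFin \o u) -> (mu j).-integrable setT (EFin \o v) ->
  (M i j).-integrable setT (EFin \o (fun z => u z.1 * v z.2)) ->
  \int[M i j]_z (u z.1 * v z.2) = (\int[mu i]_x u x) * (\int[mu j]_x v x).
Proof.
move=> ui vj uvij; rewrite /Rintegral integral_prodM// fineM//.
- exact: (integrable_fin_num measurableT ui).
- exact: (integrable_fin_num measurableT vj).
Qed.

Let a i := \int[mu i]_x sqnorm (xi x).
Let b i k := \int[mu i]_x (xi x 0 k).
Let D i j := \int[M i j]_z sqnorm (xi z.1 - xi z.2).

Let Rintegral_one i : \int[mu i]_x (1 : R) = p i.
Proof.
rewrite Rintegral_cst// mul1r.
exact: (congr1 fine (bmuT i)).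
Qed.

Let m1 (u : T -> R) : measurable_fun setT u ->
  measurable_fun setT (fun z : T * T => u z.1).
Proof. by move=> mu'; exact: (measurableT_comp mu' measurable_fst). Qed.

Let m2 (u : T -> R) : measurable_fun setT u ->
  measurable_fun setT (fun z : T * T => u z.2).
Proof. by move=> mu'; exact: (measurableT_comp mu' measurable_snd). Qed.

Let D_int i j :
  (M i j).-integrable setT (EFin \o (fun z => sqnorm (xi z.1 - xi z.2))).
Proof.
apply: (integrable_growth (qi i) (qi j) (C := 4)).
  apply: (measurableT_comp (@measurable_sqnorm R d)); apply: measurable_rVB.
  - exact: (measurableT_comp mxi measurable_fst).
  - exact: (measurableT_comp mxi measurable_snd).
move=> [x y] /=; rewrite ger0_norm ?sqnorm_ge0//.
by have := sqnormB_le (xi x) (xi y); have := sqxi_le x; have := sqxi_le y; lra.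
Qed.

Let DE i j :
  D i j = p j * a i + p i * a j - 2 * \sum_(k < d) b i k * b j k.
Proof.
(* The square is expanded under the integral. The factors 1 give the pure terms the product form
   required by [Rintegral_prodM], and integrate to the masses [p]. *)
have i1 : (M i j).-integrable setT (EFin \o (fun z => sqnorm (xi z.1) * 1)).
  apply: (integrable_growth (qi i) (qi j) (C := 2)).
    by apply: measurable_funM => //; exact: (m1 msqxi).
  move=> [x y] /=; rewrite mulr1 ger0_norm ?sqnorm_ge0//.
  by have := sqxi_le x; have := q0 y; lra.
have i2 : (M i j).-integrable setT (EFin \o (fun z => 1 * sqnorm (xi z.2))).
  apply: (integrable_growth (qi i) (qi j) (C := 2)).
    by apply: measurable_funM => //; exact: (m2 msqxi).
  move=> [x y] /=; rewrite mul1r ger0_norm ?sqnorm_ge0//.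
  by have := sqxi_le y; have := q0 x; lra.
have i3 k :
    (M i j).-integrable setT (EFin \o (fun z => xi z.1 0 k * xi z.2 0 k)).
  apply: (integrable_growth (qi i) (qi j) (C := 2)).
    apply: measurable_funM => //; first exact: (m1 (mxik k)).
    exact: (m2 (mxik k)).
  move=> [x y] /=.
  have := sqxi_le x; have := coord_sqr_le (xi x) k.
  have := sqxi_le y; have := coord_sqr_le (xi y) k.
  by rewrite ler_norml => ? ? ? ?; apply/andP; split; nra.
have i4 : (M i j).-integrable setT
    (EFin \o (fun z => \sum_(k < d) xi z.1 0 k * xi z.2 0 k)).
  rewrite (_ : _ \o _ = fun z => (\sum_(k < d) (xi z.1 0 k * xi z.2 0 k)%:E)%E).
    by apply: integrable_sum => // k _; exact: i3.
  by apply/funext => z /=; rewrite sumEFin.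
pose F1 (z : T * T) := sqnorm (xi z.1) * 1.
pose F2 (z : T * T) := 1 * sqnorm (xi z.2).
pose F4 (z : T * T) := \sum_(k < d) xi z.1 0 k * xi z.2 0 k.
have e1 : \int[M i j]_z F1 z = p j * a i.
  by rewrite (Rintegral_prodM (sqxi_int i) (one_int j) i1) Rintegral_one mulrC.
have e2 : \int[M i j]_z F2 z = p i * a j.
  by rewrite (Rintegral_prodM (one_int i) (sqxi_int j) i2) Rintegral_one.
have e4 : \int[M i j]_z (2 * F4 z) = 2 * \sum_(k < d) b i k * b j k.
  rewrite RintegralZl//; congr (_ * _); rewrite Rintegral_sum//.
  apply: eq_bigr => k _.
  by rewrite (Rintegral_prodM (xik_int i k) (xik_int j k)).
rewrite -e1 -e2 -e4 -RintegralD// -RintegralB//.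
- by apply: eq_Rintegral => z _; rewrite /F1 /F2 sqnormB mulr1 mul1r.
- rewrite (_ : _ \o _ = ((EFin \o F1) \+ (EFin \o F2))%E)//.
  exact: integrableD.
- rewrite (_ : _ \o _ = fun z => (2%:E * (EFin \o F4) z)%E).
    exact: integrableZl.
  by apply/funext => z /=; rewrite EFinM.
Qed.

Let W_convex s i j (x y : T) : 0 <= s <= 1 ->
  W (interp s x - interp s y) i j <=
  (1 - s) * W (pi2 x - pi2 y) i j + s * W (pi3 x - pi3 y) i j -
  2^-1 * kappa i j * s * (1 - s) * sqnorm (xi x - xi y).
Proof.
move=> /andP[s0 s1].
have t0 : 0 <= 1 - s by rewrite subr_ge0.
have t1 : 1 - s <= 1 by rewrite lerBlDr lerDl.
pose z2 := pi2 x - pi2 y; pose z3 := pi3 x - pi3 y.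
(* The weight is [1 - s] because [conv] attaches its parameter to the first point. *)
have := @admissible_convex _ _ _ _ _ W_adm i j (Itv01 t0 t1) z2 z3
  (in_setT _) (in_setT _).
have convE : conv (Itv01 t0 t1) (z2 : convex_lmodType V) z3 =
    (1 - s) *: z2 + s *: z3.
  by rewrite /conv/= /unstable.onem subKr.
rewrite convE.
set l := (X in X <= _); set r := (X in _ <= X).
have -> : r = (1 - s) * (W z2 i j - 2^-1 * kappa i j * sqnorm z2) +
    s * (W z3 i j - 2^-1 * kappa i j * sqnorm z3).
  by rewrite /r convRE/= /unstable.onem subKr.
rewrite /l sqnorm_interp.
have -> : interp s x - interp s y = (1 - s) *: z2 + s *: z3.
  by apply/rowP => k; rewrite !mxE; ring.
have -> : xi x - xi y = z3 - z2 by apply/rowP => k; rewrite !mxE; ring.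
lra.
Qed.

Lemma energy_generalized_geodesic (m : 'I_n -> R) (lambda : R)
    (nu2 nu3 : 'I_n -> {measure set V -> \bar R}) :
  (forall i, 0 < m i) -> (forall i, 0 < p i) ->
  (forall i, same_measure (image_measure (bmu i) (@pi2 R d)) (nu2 i)) ->
  (forall i, same_measure (image_measure (bmu i) (@pi3 R d)) (nu3 i)) ->
  \sum_j (m j)^-1 *: first_moment (nu2 j) =
    \sum_j (m j)^-1 *: first_moment (nu3 j) ->
  lambda <= lambda0 m p kappa ->
  forall s : R, 0 <= s <= 1 ->
  (interaction_energy W (fun j => image_measure (bmu j) (interp s)) <=
   (1 - s)%:E * interaction_energy W nu2 + s%:E * interaction_energy W nu3 -
   (lambda / 2 * s * (1 - s))%:E *
     \sum_j (m j)^-1%:E * \int[bmu j]_x (sqnorm (pi3 x - pi2 x))%:E)%E.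
Proof.
move=> m0 p0 nu2E nu3E nu23 lam s s01; have /andP[s0 s1] := s01.
have mom (f : {mfun T >-> V}) (nu : 'I_n -> {measure set V -> \bar R}) j k :
    same_measure (image_measure (bmu j) f) (nu j) ->
    first_moment (nu j) 0 k = \int[mu j]_x (f x 0 k).
  move=> nuE; rewrite mxE /Rintegral (integral_image_measure nuE)//.
  by apply/measurable_EFinP; exact: measurable_coord.
have coord_int (f : {mfun T >-> V}) j k : (forall x, sqnorm (f x) <= q x) ->
    (mu j).-integrable setT (EFin \o (fun x => f x 0 k : R)).
  move=> fq; apply: (@integrable_growth1 j _ 1).
    exact: (measurableT_comp (measurable_coord k) (measurable_funPT f)).
  move=> x; have := fq x; have := coord_sqr_le (f x) k.
  by rewrite ler_norml => ? ?; apply/andP; split; nra.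
have q2 x : sqnorm (pi2 x) <= q x by rewrite lerDl sqnorm_ge0.
have q3 x : sqnorm (pi3 x) <= q x by rewrite lerDr sqnorm_ge0.
(* The integral of xi against [mu j] is the difference of the first moments of [nu3 j] and [nu2 j],
   and their weighted sums agree by [nu23]. *)
have b0 k : \sum_j (m j)^-1 * b j k = 0.
  have bE j : b j k = first_moment (nu3 j) 0 k - first_moment (nu2 j) 0 k.
    rewrite (mom (@pi2 R d) _ _ _ (nu2E j)) (mom (@pi3 R d) _ _ _ (nu3E j)).
    rewrite -RintegralB//; last 2 first.
    - exact: (coord_int (@pi3 R d)).
    - exact: (coord_int (@pi2 R d)).
    by apply: eq_Rintegral => x _; rewrite !mxE.
  have /rowP/(_ k) := nu23; rewrite !summxE => /eqP.
  rewrite eq_sym -subr_eq0 -sumrB.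
  move=> /eqP h; rewrite -[RHS]h; apply: eq_bigr => j _.
  rewrite bE !mxE; ring.
have a0 i : 0 <= a i by apply: Rintegral_ge0 => x _; exact: sqnorm_ge0.
have D0 i j : 0 <= D i j by apply: Rintegral_ge0 => x _; exact: sqnorm_ge0.
have quad := quadratic_lower_bound m0 p0 (admissible_kappa_sym W_adm)
  a0 D0 DE b0 lam.
have qs x : sqnorm (interp s x) <= q x.
  have s1' : 0 <= 1 - s by rewrite subr_ge0.
  rewrite sqnorm_interp /q; have := mulr_ge0 s0 (sqnorm_ge0 (pi2 x)).
  have := mulr_ge0 s1' (sqnorm_ge0 (pi3 x)).
  have := mulr_ge0 (mulr_ge0 s0 s1') (sqnorm_ge0 (pi3 x - pi2 x)); lra.
rewrite (energyE qs)// (energyE q2 nu2E) (energyE q3 nu3E).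
have -> : (\sum_j (m j)^-1%:E * \int[bmu j]_x (sqnorm (pi3 x - pi2 x))%:E)%E =
    (\sum_j (m j)^-1 * a j)%:E.
  rewrite -sumEFin; apply: eq_bigr => j _; rewrite EFinM; congr (_ * _)%E.
  by rewrite fineK//; exact: (integrable_fin_num measurableT (sqxi_int j)).
rewrite -!EFinM -EFinD lee_fin.
have ineq i j : \int[M i j]_z W (interp s z.1 - interp s z.2) i j <=
    (1 - s) * \int[M i j]_z W (pi2 z.1 - pi2 z.2) i j +
    s * \int[M i j]_z W (pi3 z.1 - pi3 z.2) i j -
    2^-1 * kappa i j * s * (1 - s) * D i j.
  have i2 := Wint (f := @pi2 R d) i j q2.
  have i3 := Wint (f := @pi3 R d) i j q3.
  have iZ c (F : T * T -> R) : (M i j).-integrable setT (EFin \o F) ->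
      (M i j).-integrable setT (EFin \o (fun z => c * F z)).
    move=> Fi; rewrite (_ : _ \o _ = fun z => (c%:E * (EFin \o F) z)%E).
      exact: integrableZl.
    by apply/funext => z /=; rewrite EFinM.
  rewrite -!RintegralZl//; last exact: D_int.
  have i23 := integrableD measurableT (iZ (1 - s) _ i2) (iZ s _ i3).
  have iD := iZ (2^-1 * kappa i j * s * (1 - s)) _ (D_int i j).
  rewrite -RintegralD//; [|exact: iZ|exact: iZ].
  rewrite -RintegralB//.
  apply: le_Rintegral => //.
  - exact: Wint.
  - exact: (integrableB measurableT i23 iD).
  - by move=> z _; exact: W_convex.
set w := fun (f : T -> V) => \sum_i \sum_j \int[M i j]_z W (f z.1 - f z.2) i j.
have sum_ineq : w (interp s) <= (1 - s) * w (@pi2 R d) + s * w (@pi3 R d) -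
    2^-1 * s * (1 - s) * \sum_i \sum_j kappa i j * D i j.
  rewrite /w !mulr_sumr -big_split -sumrB; apply: ler_sum => i _ /=.
  rewrite !mulr_sumr -big_split -sumrB; apply: ler_sum => j _ /=.
  apply: (le_trans (ineq i j)).
  by rewrite le_eqVlt; apply/orP; left; apply/eqP; ring.
have ss : 0 <= s * (1 - s) by rewrite mulr_ge0// subr_ge0.
have half0 : 0 <= 2^-1 :> R by rewrite invr_ge0.
(* The gap in the claim is exactly half the gap in [sum_ineq] plus [s * (1 - s) / 2] times the gap
   in [quad]. *)
have h1 := mulr_ge0 half0 (eqbRL (subr_ge0 _ _) sum_ineq).
have h2 := mulr_ge0 half0 (mulr_ge0 ss (eqbRL (subr_ge0 _ _) quad)).
rewrite -subr_ge0; apply: (le_trans (addr_ge0 h1 h2)).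
by rewrite le_eqVlt; apply/orP; left; apply/eqP; rewrite /w; ring.
Qed.

End energy_convexity.

Theorem theorem2p7 (R : realType) (d n : nat) (m p : 'I_n -> R)
    (E : 'rV[R]_d) (W : 'rV[R]_d -> 'M[R]_n) (kappa : 'M[R]_n)
    (n_gt1 : (1 < n)%N)
    (m_gt0 : forall i, 0 < m i) (p_gt0 : forall i, 0 < p i)
    (W_admissible : admissible W kappa)
    (W_irreducible : irreducible_system W)
    (lambda : R) (lambda_le : lambda <= lambda0 m p kappa) :
  convex_along_generalized_geodesics m p E lambda (interaction_energy W).
Proof.
move=> mu1 mu2 mu3 [mu1T _ _] [mu2T mu2s mu2E] [mu3T mu3s mu3E].
have /choice[bmu bmuP] j :=
  generalized_plan_exists (p_gt0 j) (mu1T j) (mu2T j) (mu3T j).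
have bmu1 j : same_measure (image_measure (bmu j) (@pi1 R d)) (mu1 j).
  by case: (bmuP j).
have bmu2 j : same_measure (image_measure (bmu j) (@pi2 R d)) (mu2 j).
  by case: (bmuP j).
have bmu3 j : same_measure (image_measure (bmu j) (@pi3 R d)) (mu3 j).
  by case: (bmuP j).
have bmuT j : bmu j setT = (p j)%:E by rewrite -mu1T -bmu1.
have msq : measurable_fun setT (fun x : 'rV[R]_d => (sqnorm x)%:E).
  by apply/measurable_EFinP; exact: measurable_sqnorm.
exists bmu; split => [j|j|].
- by split.
- by case: (bmuP j).
(* Membership of [mu2] and [mu3] in [state_space] enters through their finite second moments, which
   give integrability, and through the common barycenter [E]. *)
- apply: (energy_generalized_geodesic W_admissible bmuT _ _ m_gt0 p_gt0
    bmu2 bmu3 _ lambda_le).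
  + by move=> j; rewrite -(integral_image_measure (bmu2 j) msq).
  + by move=> j; rewrite -(integral_image_measure (bmu3 j) msq).
  + by rewrite mu2E mu3E.
Qed.
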